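(* There are positive constants $c_1,c_2$ such that for every fixed $d\geq 1$, almost surely (as $n\to\infty$) $$2^{c_1d}\, n \leq r(G(n,n,d/n)) \leq 2^{c_2 d}\, n.$$
   Context: The Ramsey number $r(H)$ of a graph $H$ is the least positive integer $N$ such that every two-coloring of the edges of $K_N$ contains a monochromatic copy of $H$. The random bipartite graph $G(n,n,p)$ is the random labeled bipartite graph with $n$ vertices in each class, where each of the $n^2$ possible edges between the classes appears independently with probability $p$. Almost surely means with probability tending to $1$ as $n\to\infty$. *)

(* Defs.v *)
From mathcomp Require Import all_boot all_order all_algebra.
From mathcomp Require Import reals.

Set Implicit Arguments.
Unset Strict Implicit.
Unset Printing Implicit Defensive.

Import Order.TTheory GRing.Theory Num.Theory.

Record sgraph := SGraph {
  vertex :> finType;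
  edge : rel vertex;
  edge_sym : symmetric edge;
  edge_irr : irreflexive edge }.

(* A two-coloring of the edges of the complete graph on ['I_N] is a map
   [c : {ffun {set 'I_N} -> bool}]; only its values on two-element sets are
   ever inspected. *)
Definition mono_copy (H : sgraph) (N : nat) (c : {ffun {set 'I_N} -> bool}) :=
  [exists b : bool, [exists f : {ffun H -> 'I_N}, injectiveb f &&
    [forall x : H, forall y : H, edge x y ==> (c [set f x; f y] == b)]]].

Definition ramsey_arrow (H : sgraph) (N : nat) : bool :=
  (0 < N) && [forall c : {ffun {set 'I_N} -> bool}, mono_copy H c].

Lemma ramsey_cliques (a b : nat) : exists N : nat,
  forall (T : finType) (c : {set T} -> bool) (A : {set T}), N <= #|A| ->
  exists (k : bool) (S : {set T}),
    [/\ S \subset A, #|S| = (if k then a else b)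
      & forall x y, x \in S -> y \in S -> x != y -> c [set x; y] = k].
Proof.
have [m] := ubnP (a + b); elim: m a b => // m IHm [|a] [|b] lt_ab.
1-2: by exists 0 => T c A _; exists true, set0; rewrite sub0set cards0;
  split=> // x y; rewrite inE.
  by exists 0 => T c A _; exists false, set0; rewrite sub0set cards0;
  split=> // x y; rewrite inE.
have [|N1 HN1] := IHm a b.+1; first by rewrite addSn ltnS in lt_ab.
have [|N2 HN2] := IHm a.+1 b; first by rewrite addnS ltnS in lt_ab.
exists (N1 + N2).+1 => T c A leA.
have /card_gt0P[v vA] : 0 < #|A| by apply: leq_trans leA.
have add_v k (S : {set T}) n : S \subset [set x in A :\ v | c [set v; x] == k] ->
  #|S| = n -> (forall x y, x \in S -> y \in S -> x != y -> c [set x; y] = k) ->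
  [/\ v |: S \subset A, #|v |: S| = n.+1 & forall x y, x \in v |: S ->
    y \in v |: S -> x != y -> c [set x; y] = k].
  move=> sSA cS HS; have HvS x : x \in S -> c [set v; x] = k.
    by move/(subsetP sSA); rewrite !inE => /andP[_ /eqP].
  have vS : v \notin S.
    by apply/negP => /(subsetP sSA); rewrite !inE eqxx.
  split; last 1 first.
  - move=> x y /setU1P[->|xS] /setU1P[->|yS] //; first by rewrite eqxx.
    + by move=> _; apply: HvS.
    + by move=> _; rewrite setUC; apply: HvS.
    + exact: HS.
  - rewrite subUset sub1set vA /=; apply: subset_trans sSA _.
    by apply/subsetP => x; rewrite !inE => /andP[/andP[]].
  - by rewrite cardsU1 vS cS.
pose B k := [set x in A :\ v | c [set v; x] == k].
have cB : N1 + N2 <= #|B true| + #|B false|.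
  move: leA; rewrite (cardsD1 v A) vA ltnS => /leq_trans; apply.
  rewrite -(cardsID [set x | c [set v; x]] (A :\ v)).
  apply: leq_add; apply: subset_leq_card; apply/subsetP => x;
    rewrite !inE; first by rewrite eqb_id.
  by rewrite eqbF_neg => /andP[-> ->].
have sBA k : B k \subset A.
  by apply/subsetP => x; rewrite !inE => /andP[/andP[]].
have [le1|lt1] := leqP N1 #|B true|.
  have [[] [S [sS cS HS]]] := HN1 T c _ le1.
    by exists true, (v |: S); apply: add_v.
  by exists false, S; split=> //; apply: subset_trans sS (sBA _).
have le2 : N2 <= #|B false|.
  by rewrite -(leq_add2l N1); apply: leq_trans cB _; rewrite leq_add2r ltnW.
have [[] [S [sS cS HS]]] := HN2 T c _ le2.
  by exists true, S; split=> //; apply: subset_trans sS (sBA _).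
by exists false, (v |: S); apply: add_v.
Qed.

Lemma ramsey_exists (H : sgraph) : exists N, ramsey_arrow H N.
Proof.
have [N HN] := ramsey_cliques #|H| #|H|.
exists N.+1; apply/andP; split=> //; apply/forallP => c.
have [|k [S [_ cS HS]]] := HN _ (fun X => c X) [set: 'I_N.+1].
  by rewrite cardsT card_ord.
have {}cS : #|H| = #|S| by rewrite cS; case: k {HS cS}.
apply/existsP; exists k; apply/existsP.
exists [ffun x => enum_val (cast_ord cS (enum_rank x))].
have inj : injective (fun x : H => enum_val (cast_ord cS (enum_rank x))).
  by move=> x y /enum_val_inj /cast_ord_inj /enum_rank_inj.
apply/andP; split.
  by apply/injectiveP => x y; rewrite !ffunE => /inj.
apply/forallP => x; apply/forallP => y; apply/implyP => exy; rewrite !ffunE.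
apply/eqP/HS; rewrite ?enum_valP //.
by apply/eqP => /inj eq_xy; rewrite eq_xy edge_irr in exy.
Qed.

Definition ramsey (H : sgraph) : nat := ex_minn (ramsey_exists H).

Section RandomBipartite.
Variable n : nat.

Definition bip_edge (E : {set 'I_n * 'I_n}) : rel ('I_n + 'I_n)%type :=
  fun u v => match u, v with
  | inl i, inr j => (i, j) \in E
  | inr j, inl i => (i, j) \in E
  | _, _ => false
  end.

Lemma bip_edge_sym E : symmetric (bip_edge E).
Proof. by move=> [i|j] [i'|j']. Qed.

Lemma bip_edge_irr E : irreflexive (bip_edge E).
Proof. by move=> [i|j]. Qed.

Definition bip_graph (E : {set 'I_n * 'I_n}) : sgraph :=
  SGraph (bip_edge_sym E) (bip_edge_irr E).

Local Open Scope ring_scope.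

(* The law of G(n,n,p) on edge sets: each pair is an edge independently with
   probability [p].  This is a probability only for [0 <= p <= 1]. *)
Definition Gnnp_weight (R : realType) (p : R) (E : {set 'I_n * 'I_n}) : R :=
  \prod_(e : 'I_n * 'I_n) (if e \in E then p else 1 - p).

Definition Gnnp_prob (R : realType) (p : R) (A : pred sgraph) : R :=
  \sum_(E : {set 'I_n * 'I_n} | A (bip_graph E)) Gnnp_weight p E.

End RandomBipartite.

(* Main.v *)
Require Import Defs.
From mathcomp Require Import all_boot all_order all_algebra.
From mathcomp Require Import reals zify ring lra.

(* Lower bound: colour the edges of K_N by <pi u, pi v>, where pi cuts [N] into
   blocks of size about n / 2^(r+1) indexed by F_2^(2r).  A monochromatic copy of H
   induces a labelling of its vertices by F_2^(2r) with small fibres, and by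
   Lindsey's inequality such a labelling gives the wrong colour to at least a
   quarter of the n^2 pairs, none of which may be an edge.  For r = d / 32 this
   is too unlikely to survive the union bound over the 2^(4rn) labellings.

   Upper bound: the vertices of degree more than s = O(d) are so rare, and small
   sets so sparse, that they can be enclosed in a small set to which every other
   vertex sends at most one edge.  Iterating inside this set orders H so that
   every vertex v has at most s earlier neighbours, and at most s later
   neighbours that also have a neighbour before v.  In the denser colour
   of a complete graph on 2^O(s) n vertices, two rounds of dependent random
   choice give sets U1, U2 such that almost all s-tuples in either one have many
   common neighbours in the other; H is then embedded greedily, keeping the
   embedded neighbourhood of each remaining vertex typical. *)

Set Implicit Arguments.
Unset Strict Implicit.
Unset Printing Implicit Defensive.
Import Order.TTheory GRing.Theory Num.Theory.

(** * Greedy embedding into a pair of typical sets *)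

Lemma card_bigcup_le (I T : finType) (P : pred I) (A : I -> {set T}) :
  #|\bigcup_(i | P i) A i| <= \sum_(i | P i) #|A i|.
Proof.
elim/big_rec2: _ => [|i m B _ le_Bm]; first by rewrite cards0.
by apply: leq_trans (leq_card_setU _ _) _; rewrite leq_add2l.
Qed.

Section CommonNeighbours.
Variables (V : finType) (G : rel V).

Definition common (W S : {set V}) := [set y in W | [forall x in S, G x y]].

Lemma commonP (W S : {set V}) y :
  reflect (y \in W /\ {in S, forall x, G x y}) (y \in common W S).
Proof.
by rewrite inE; apply: (iffP andP) => -[yW] => [/forall_inP|H];
  split=> //; apply/forall_inP.
Qed.

Lemma common_sub (W S : {set V}) : common W S \subset W.
Proof. by apply/subsetP => y /commonP[]. Qed.

Lemma commonS (W S S' : {set V}) : S \subset S' -> common W S' \subset common W S.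
Proof.
move=> sub; apply/subsetP => y /commonP[yW H]; apply/commonP; split=> // x xS.
by apply: H; apply: (subsetP sub).
Qed.

Lemma commonU (W S T : {set V}) :
  common W (S :|: T) = common W S :&: common setT T.
Proof.
apply/setP => y; apply/commonP/setIP => [[yW H]|[/commonP[yW H1] /commonP[_ H2]]].
  by split; apply/commonP; split=> // x xS; apply: H; rewrite inE xS ?orbT.
by split=> // x /setUP[]; [apply: H1 | apply: H2].
Qed.

End CommonNeighbours.

Section Embedding.
Variables (V : finType) (G : rel V) (U : bool -> {set V}) (lam gam : bool -> nat).

(* [good b j S]: [S \subset U b] has many common neighbours on the other side,
   and this survives [j] further additions of typical vertices of [U b]. *)
Fixpoint good (b : bool) (j : nat) (S : {set V}) : bool :=
  if j is j'.+1 then #|[set u in U b | ~~ good b j' (u |: S)]| <= gam b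
  else lam (~~ b) <= #|common G (U (~~ b)) S|.

Definition bad_tuples b j (S : {set V}) :=
  [set t : {ffun 'I_j -> V} | (t \in ffun_on (mem (U b))) &&
    (#|common G (U (~~ b)) (S :|: [set t i | i : 'I_j])| < lam (~~ b))].

Hypothesis gam_lt : forall b, gam b < #|U b|.

(** Fewer than [#|U b|] vertices are atypical, so a typical one can be added [j] times; dropping the
    added vertices only enlarges the common neighbourhood. *)
Lemma good_common b j S : good b j S -> lam (~~ b) <= #|common G (U (~~ b)) S|.
Proof.
elim: j S => //= j IHj S le_bad.
have [u uU gu] : exists2 u, u \in U b & good b j (u |: S).
  have : [set u in U b | ~~ good b j (u |: S)] \proper U b.
    rewrite properEcard (leq_ltn_trans le_bad) // andbT.
    by apply/subsetP => u; rewrite inE => /andP[].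
  case/properP => _ [u uU]; rewrite inE uU /= negbK => gu; by exists u.
apply: leq_trans (IHj _ gu) _; apply: subset_leq_card; apply: commonS.
exact: subsetUr.
Qed.

Let tcons j (p : V * {ffun 'I_j -> V}) : {ffun 'I_j.+1 -> V} :=
  [ffun i => if unlift ord0 i is Some i' then p.2 i' else p.1].

Let tcons_inj j : injective (@tcons j).
Proof.
move=> [u t] [u' t'] /ffunP eq_t; congr (_, _).
  by have:= eq_t ord0; rewrite !ffunE unlift_none.
by apply/ffunP => i; have:= eq_t (lift ord0 i); rewrite !ffunE liftK.
Qed.

Let tcons_im j u (t : {ffun 'I_j -> V}) :
  [set tcons (u, t) i | i : 'I_j.+1] = u |: [set t i | i : 'I_j].
Proof.
apply/setP => x; apply/imsetP/setU1P => [[i _ ->]|[->|/imsetP[i _ ->]]].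
- rewrite ffunE; case: unliftP => [i' _|_]; last by left.
  by right; apply/imsetP; exists i'.
- by exists ord0 => //; rewrite ffunE unlift_none.
- by exists (lift ord0 i) => //; rewrite ffunE liftK.
Qed.

(** Failure at depth [j.+1] leaves more than [gam b] first entries, each failing again at depth [j],
    and the branches give distinct tuples. Contrapositively, a count of bad tuples makes the empty
    set good. *)
Lemma bad_tuples_ge b j S :
  ~~ good b j S -> (gam b).+1 ^ j <= #|bad_tuples b j S|.
Proof.
elim: j S => [|j IHj] S /=.
  rewrite -ltnNge => lt; rewrite expn0 card_gt0; apply/set0Pn.
  exists (ffun0 (card_ord 0)); rewrite inE; apply/andP; split.
    by apply/ffun_onP => -[].
  apply: leq_ltn_trans lt; apply: subset_leq_card; apply: commonS.
  exact: subsetUl.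
rewrite -ltnNge => lt; set B := [set u in U b | _] in lt.
pose P := [set p : V * {ffun 'I_j -> V} | (p.1 \in B)
                                        && (p.2 \in bad_tuples b j (p.1 |: S))].
have cP : #|P| = \sum_(u in B) #|bad_tuples b j (u |: S)|.
  under eq_bigr => u _ do rewrite -sum1_card.
  by rewrite pair_big_dep /= -sum1_card; apply: eq_bigl => p; rewrite inE.
apply: (@leq_trans #|P|).
  rewrite cP expnS; apply: (@leq_trans (#|B| * (gam b).+1 ^ j)).
    by rewrite leq_mul2r lt orbT.
  rewrite -sum_nat_const; apply: leq_sum => u; rewrite inE => /andP[_ ?].
  exact: IHj.
rewrite -(card_imset P (@tcons_inj j)); apply: subset_leq_card.
apply/subsetP => _ /imsetP[[u t] + ->]; rewrite !inE /=.
case/andP=> /andP[uU _] /andP[/ffun_onP tU small]; rewrite tcons_im.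
rewrite setUCA setUA small andbT; apply/ffun_onP => i; rewrite ffunE.
by case: unliftP => [i' _|_ //]; apply: tU.
Qed.

Variables (H : finType) (e : rel H) (side : H -> bool) (s : nat) (r : H -> nat).
Hypothesis G_sym : symmetric G.
Hypothesis e_sym : symmetric e.
Hypothesis e_side : forall v w, e v w -> side w = ~~ side v.
Hypothesis r_inj : injective r.
Hypothesis few_before : forall v, #|[set w | e v w & r w < r v]| <= s.
Hypothesis few_constrained : forall v,
  #|[set w | e v w & (r v < r w) && [exists x, e w x && (r x < r v)]]| <= s.
Hypothesis s_gt0 : 0 < s.
Hypothesis good_start : forall b, good b s set0.
Hypothesis room : forall b, #|H| + s.+1 * gam b < lam b.

Let nb w k := [set x | e w x & r x < k].

(** In the last clause the neighbours of [w] lie on the side opposite to [w], and the remaining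
    depth bounds how many more of them can still precede [w]. *)
Let partial k (f : H -> V) :=
  [/\ forall v, r v < k -> f v \in U (side v),
      forall v w, r v < k -> r w < k -> f v = f w -> v = w,
      forall v w, r v < k -> r w < k -> e v w -> G (f v) (f w)
    & forall w, k <= r w -> good (~~ side w) (s - #|nb w k|) (f @: nb w k)].

Let few_nb w k : k <= r w -> #|nb w k| <= s.
Proof.
move=> le_kw; apply: leq_trans (few_before w); apply: subset_leq_card.
by apply/subsetP => x; rewrite !inE => /andP[-> /leq_trans]; apply.
Qed.

(** The vertex of rank [k] goes to a common neighbour of its embedded neighbourhood, avoiding used
    vertices and those atypical for a later neighbour. Later neighbours with nothing embedded yet
    share the single atypical set [B0]; only the at most [s] constrained ones need a set each. This
    explains [s.+1] in [room]. *)
Lemma extend_partial k f : partial k f -> exists f', partial k.+1 f'.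
Proof.
case=> fU f_inj fG f_good.
case: (pickP [pred v | r v == k]) => [v /eqP rv|no_v]; last first.
  have lt_k v : (r v < k.+1) = (r v < k).
    by rewrite ltnS leq_eqVlt; have /= -> := no_v v.
  have nbE w : nb w k.+1 = nb w k by apply/setP => x; rewrite !inE lt_k.
  exists f; split=> [v|v w|v w|w]; rewrite ?lt_k ?nbE; first exact: fU.
  - exact: f_inj.
  - exact: fG.
  - by move=> /ltnW; apply: f_good.
have lt_kS x : (r x < k.+1) = (x == v) || (r x < k).
  by rewrite ltnS leq_eqVlt -rv (inj_eq r_inj).
pose C := [set w | e v w & (r v < r w) && [exists x, e w x && (r x < r v)]].
pose bad j S := [set u in U (side v) | ~~ good (side v) j (u |: S)].
pose B0 := bad s.-1 set0.
pose Bw w := bad (s - #|nb w k|).-1 (f @: nb w k).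
pose A := common G (U (side v)) (f @: nb v k).
pose X := f @: [set x | r x < k] :|: B0 :|: \bigcup_(w in C) Bw w.
have cA : lam (side v) <= #|A|.
  by have:= good_common (f_good v (eq_leq (esym rv))); rewrite negbK.
(* Since [v] is itself an earlier neighbour of [w], one level of goodness is left to spend on it. *)
have e_vw_s w : e v w -> r v < r w -> #|nb w k| < s.
  move=> evw lt; have: #|nb w k.+1| <= s by apply: few_nb; rewrite -rv.
  apply: leq_trans; rewrite [in X in _ <= X](cardsD1 v) !inE e_sym evw rv ltnSn add1n ltnS.
  apply: subset_leq_card; apply/subsetP => x; rewrite !inE lt_kS.
  case/andP=> -> lt_x; rewrite lt_x orbT !andbT.
  by apply/eqP => x_v; rewrite x_v rv ltnn in lt_x.
have cX : #|X| <= #|H| + s.+1 * gam (side v).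
  rewrite mulSn addnA; apply: leq_trans (leq_card_setU _ _) _; apply: leq_add.
    apply: leq_trans (leq_card_setU _ _) _; apply: leq_add.
      by apply: leq_trans (leq_imset_card _ _) _; apply: max_card.
    by have:= good_start (side v); rewrite -[in good _ s _](prednK s_gt0).
  apply: leq_trans (card_bigcup_le _ _) _.
  apply: (@leq_trans (\sum_(w in C) gam (side v))); last first.
    by rewrite sum_nat_const leq_mul2r few_constrained orbT.
  apply: leq_sum => w; rewrite inE => /andP[evw /andP[lt_vw _]].
  have:= f_good w; rewrite -rv (e_side evw) negbK => /(_ (ltnW lt_vw)).
  by rewrite rv -[s - _](prednK _) // subn_gt0 e_vw_s.
have [u uA uX] : exists2 u, u \in A & u \notin X.
  apply/subsetPn; apply/negP => /subset_leq_card; rewrite leqNgt => /negP[].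
  by apply: leq_ltn_trans cX _; apply: leq_trans (room _) cA.
have [uU uG] := commonP _ _ _ _ uA.
move: uX; rewrite 2!in_setU !negb_or -andbA => /and3P[u_new uB0 uBw].
have {}u_new x : r x < k -> f x <> u.
  by move=> lt_x fxu; case/negP: u_new; apply/imsetP; exists x; rewrite ?inE.
pose f' x := if x == v then u else f x.
have f'E x : r x < k -> f' x = f x.
  by move=> lt_x; rewrite /f' ifN //; apply/eqP => x_v; rewrite x_v rv ltnn in lt_x.
have f'v : f' v = u by rewrite /f' eqxx.
have f'nb w : f' @: nb w k = f @: nb w k.
  by apply: eq_in_imset => x; rewrite inE => /andP[_ /f'E].
have Gu w : r w < k -> e v w -> G (f w) u.
  by move=> lt_w evw; apply: uG; apply: imset_f; rewrite inE evw.
exists f'; split=> [x|x y|x y|w].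
- by rewrite lt_kS => /orP[/eqP->|lt_x]; rewrite ?f'v // f'E //; apply: fU.
- rewrite !lt_kS => /orP[/eqP->|lt_x] /orP[/eqP->|lt_y] //; rewrite ?f'v ?f'E //.
  + by move/esym/u_new.
  + by move/u_new.
  + exact: f_inj.
- rewrite !lt_kS => /orP[/eqP->|lt_x] /orP[/eqP->|lt_y]; rewrite ?f'v ?f'E //.
  + by move=> evv; have:= e_side evv; case: (side v).
  + by move=> evy; rewrite G_sym; apply: Gu.
  + by rewrite e_sym; apply: Gu.
  + exact: fG.
move=> lt_kw; have [evw|not_evw] := boolP (e v w); last first.
  have -> : nb w k.+1 = nb w k.
    apply/setP => x; rewrite !inE lt_kS; case: eqP => // ->.
    by rewrite e_sym (negPf not_evw).
  by rewrite f'nb; apply: f_good; apply: ltnW.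
have nbE : nb w k.+1 = v |: nb w k.
  apply/setP => x; rewrite !inE lt_kS; case: eqP => // ->.
  by rewrite e_sym evw.
have v_nb : v \notin nb w k by rewrite inE rv ltnn andbF.
rewrite nbE imsetU1 f'v f'nb cardsU1 v_nb add1n subnS (e_side evw) negbK.
have [nb0|/set0Pn[x]] := eqVneq (nb w k) set0.
  move: uB0; rewrite !inE uU /= negbK nb0 cards0 subn0 imset0; exact.
rewrite inE => /andP[ewx lt_x].
have wC : w \in C.
  by rewrite inE evw rv lt_kw /=; apply/existsP; exists x; rewrite ewx.
apply: contraNT uBw => not_good; apply/bigcupP; exists w => //.
by rewrite !inE uU.
Qed.

Lemma embedding : exists2 f : H -> V, injective f & forall v w, e v w -> G (f v) (f w).
Proof.
have /set0Pn[u0 _] : U true != set0.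
  by rewrite -card_gt0; apply: leq_ltn_trans (gam_lt true).
have step k : exists f, partial k f.
  elim: k => [|k [f /extend_partial//]].
  exists (fun=> u0); split=> // w _.
  have -> : nb w 0 = set0 by apply/setP => x; rewrite !inE ltn0 andbF.
  by rewrite imset0 cards0 subn0.
have [f [_ f_inj fG _]] := step (\max_v r v).+1.
have lt_r v : r v < (\max_v r v).+1 by rewrite ltnS leq_bigmax.
by exists f => [v w|v w]; [apply: f_inj | apply: fG].
Qed.

End Embedding.

(** * Orderings of graphs whose small subgraphs are sparse *)

Section Ordering.
Variables (H : finType) (e : rel H) (s : nat).
Hypothesis e_sym : symmetric e.

Definition degree (Z : {set H}) v := #|[set w in Z | e v w]|.

Lemma degreeS (Z Z' : {set H}) v : Z \subset Z' -> degree Z v <= degree Z' v.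
Proof.
move=> sub; apply: subset_leq_card; apply/subsetP => w; rewrite !inE => /andP[wZ ->].
by rewrite (subsetP sub).
Qed.

Definition peelable := forall Y : {set H}, Y != set0 -> exists X : {set H},
  X \proper Y /\ {in Y :\: X, forall v, degree Y v <= s /\ degree X v <= 1}.

(** [X] is ordered recursively and [Y :\: X] is put after it in any order. A vertex outside [X] has
    at most [s] neighbours in [Y]. A vertex outside [X] adjacent to [v] in [X] has no other
    neighbour in [X], hence none before [v]; so both bounds for [v] are inherited from [X]. *)
Lemma ordering_on : peelable -> forall Y : {set H}, exists r : H -> nat,
  [/\ {in Y, forall v, r v < #|Y|}, {in Y &, injective r},
      {in Y, forall v, #|[set w in Y | e v w & r w < r v]| <= s}
    & {in Y, forall v, #|[set w in Y | e v w &
         (r v < r w) && [exists x in Y, e w x && (r x < r v)]]| <= s}].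
Proof.
move=> peel Y; have [m] := ubnP #|Y|; elim: m Y => // m IHm Y; rewrite ltnS => leYm.
have [->|Y_n0] := eqVneq Y set0.
  by exists (fun=> 0); split=> v; rewrite inE.
have [X [ltXY low]] := peel Y Y_n0.
have sXY := proper_sub ltXY.
have [r [r_lt r_inj r1 r2]] := IHm X (leq_trans (proper_card ltXY) leYm).
pose q v := if v \in X then r v else #|X| + index v (enum (Y :\: X)).
have qX v : v \in X -> q v = r v by rewrite /q => ->.
have q_lt v : v \in Y -> (q v < #|X|) = (v \in X).
  move=> vY; rewrite /q; case: ifP => [/r_lt //|_].
  by rewrite ltnNge leq_addr.
have low_deg v : v \in Y -> v \notin X -> degree Y v <= s.
  by move=> vY vX; have [|//] := low v; rewrite inE vX.
exists q; split=> [v vY|v w vY wY|v vY|v vY].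
- rewrite /q; case: ifP => [/r_lt lt|vX].
    by apply: leq_trans lt _; apply: subset_leq_card.
  rewrite -(cardsID X Y) (setIidPr sXY) ltn_add2l [X in _ < X]cardE index_mem.
  by rewrite mem_enum inE vX.
- case vX: (v \in X); case wX: (w \in X).
  + by rewrite !qX //; apply: r_inj.
  + by move=> q_vw; have:= q_lt v vY; rewrite q_vw q_lt // vX wX.
  + by move=> q_vw; have:= q_lt v vY; rewrite q_vw q_lt // vX wX.
  rewrite /q vX wX => /addnI /(congr1 (nth v (enum (Y :\: X)))).
  by rewrite !nth_index // mem_enum inE ?vX ?wX.
- have [vX|vX] := boolP (v \in X); last first.
    apply: leq_trans (low_deg v vY vX); apply: subset_leq_card.
    by apply/subsetP => w; rewrite !inE => /and3P[-> ->].
  apply: leq_trans (r1 v vX); apply: subset_leq_card.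
  apply/subsetP => w; rewrite !inE => /and3P[wY evw lt_wv].
  have wX : w \in X by rewrite -q_lt // (ltn_trans lt_wv) // q_lt.
  by rewrite wX evw -!qX.
have [vX|vX] := boolP (v \in X); last first.
  apply: leq_trans (low_deg v vY vX); apply: subset_leq_card.
  by apply/subsetP => w; rewrite !inE => /and3P[-> ->].
apply: leq_trans (r2 v vX); apply: subset_leq_card.
apply/subsetP => w; rewrite !inE => /and4P[wY evw lt_vw].
case/exists_inP=> x xY /andP[ewx lt_xv].
have xX : x \in X by rewrite -q_lt // (ltn_trans lt_xv) // q_lt.
have wX : w \in X.
  have x_v : x != v by apply: contraTneq lt_xv => ->; rewrite ltnn.
  apply: contraT => wX; have [|_] := low w; first by rewrite inE wX.
  rewrite leqNgt => /negP[]; apply: (@leq_trans #|[set x; v]|).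
    by rewrite cards2 x_v.
  apply: subset_leq_card; apply/subsetP => y.
  by rewrite !inE => /orP[]/eqP->; rewrite ?xX ?vX // e_sym.
rewrite wX evw -!qX // lt_vw; apply/exists_inP; exists x => //.
by rewrite ewx -!qX.
Qed.

Lemma degree_ordering : peelable -> exists r : H -> nat,
  [/\ injective r, forall v, #|[set w | e v w & r w < r v]| <= s
    & forall v, #|[set w | e v w &
         (r v < r w) && [exists x, e w x && (r x < r v)]]| <= s].
Proof.
case/ordering_on/(_ setT) => r [_ r_inj r1 r2]; exists r.
split=> [v w|v|v]; first by apply: r_inj; rewrite inE.
  apply: leq_trans (r1 v (in_setT v)); apply: subset_leq_card.
  by apply/subsetP => w; rewrite !inE.
apply: leq_trans (r2 v (in_setT v)); apply: subset_leq_card.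
apply/subsetP => w; rewrite !inE => /and3P[-> -> /existsP[x xP]].
by apply/exists_inP; exists x.
Qed.

Lemma degree_sum_setU1 (X : {set H}) v : v \notin X ->
  \sum_(w in X) degree X w + (degree X v).*2
    <= \sum_(w in v |: X) degree (v |: X) w.
Proof.
move=> vX; rewrite big_setU1 //= -addnn addnA addnC leq_add //.
  by apply: degreeS; apply: subsetUr.
have -> : degree X v = \sum_(w in X) e w v.
  rewrite /degree -sum1_card big_mkcond [RHS]big_mkcond /=; apply: eq_bigr => w _.
  by rewrite inE e_sym; case: (w \in X); case: (e w v).
rewrite -big_split /=; apply: leq_sum => w wX.
rewrite /degree addnC -(cardsID [set v] [set x in v |: X | e w x]); apply: leq_add.
  case ewv: (e w v) => //=; rewrite card_gt0; apply/set0Pn; exists v.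
  by rewrite !inE eqxx ewv.
apply: subset_leq_card; apply/subsetP => x; rewrite !inE => /andP[xX ->].
by rewrite xX orbT !andbT; apply: contraNneq vX => <-.
Qed.

(* Repeatedly adding a vertex with two neighbours in the current set adds two
   edges per vertex; were X0 to quadruple, the set would be too dense. *)
Lemma closure_two_neighbours (X0 Y : {set H}) : X0 \subset Y ->
  (forall Z : {set H}, Z != set0 -> #|Z| <= 4 * #|X0| ->
     \sum_(w in Z) degree Z w < 3 * #|Z|) ->
  exists X : {set H}, [/\ X0 \subset X, X \subset Y, #|X| <= 4 * #|X0|
    & {in Y :\: X, forall v, degree X v <= 1}].
Proof.
move=> sX0Y sparse.
(* Each added vertex brings two edges, that is 4 in the degree sum. At size [4 * #|X0|] the sum
   would reach [12 * #|X0|], three times the size, against sparsity. *)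
pose P (X : {set H}) := [&& X0 \subset X, X \subset Y, #|X| <= 4 * #|X0|
   & 4 * (#|X| - #|X0|) <= \sum_(w in X) degree X w].
have P0 : P X0 by rewrite /P subxx sX0Y subnn muln0 leq_pmull.
case: (arg_maxnP (fun X : {set H} => #|X|) P0) => X /and4P[sX0X sXY cX eX] maxX.
exists X; split=> // v; rewrite inE => /andP[vX vY]; rewrite leqNgt.
apply/negP => deg2; have := degree_sum_setU1 vX.
have leX0X := subset_leq_card sX0X.
have [lt_cX|ge_cX] := ltnP #|X| (4 * #|X0|); last first.
  have [X0_0|X0_n0] := posnP #|X0|.
    move: deg2; rewrite X0_0 muln0 leqn0 cards_eq0 in cX; rewrite (eqP cX).
    rewrite /degree (_ : [set w in set0 | e v w] = set0) ?cards0 //.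
    by apply/setP => w; rewrite !inE.
  have := sparse X; rewrite -card_gt0; lia.
move=> lt_e; have := maxX (v |: X); rewrite cardsU1 vX /= leqNgt add1n ltnSn.
case/(_ _)/negP => //; rewrite /P cardsU1 vX add1n subUset sub1set vY sXY.
rewrite (subset_trans sX0X (subsetUr _ _)) lt_cX /=; lia.
Qed.

(** [X] is the closure of the vertices of degree above [s] in [Y]. It is proper: either [Y] has more
    than [z] vertices, or [Y] is sparse itself and [13 * #|X0| < 3 * #|Y|], which gives
    [4 * #|X0| < #|Y|]. *)
Lemma sparse_peelable (z : nat) : 12 <= s ->
  4 * #|[set v | s < degree setT v]| <= z ->
  (forall Z : {set H}, Z != set0 -> #|Z| <= z ->
     \sum_(w in Z) degree Z w < 3 * #|Z|) ->
  peelable.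
Proof.
move=> s12 few_high sparse Y Y_n0.
pose X0 := [set v in Y | s < degree Y v].
have sX0Y : X0 \subset Y by apply/subsetP => v; rewrite inE => /andP[].
have cX0 : 4 * #|X0| <= z.
  apply: leq_trans few_high; rewrite leq_mul2l; apply: subset_leq_card.
  apply/subsetP => v; rewrite !inE => /andP[_ lt]; apply: leq_trans lt _.
  by apply: degreeS; apply: subsetT.
have [X [sX0X sXY cX low]] :
    exists X : {set H}, [/\ X0 \subset X, X \subset Y, #|X| <= 4 * #|X0|
      & {in Y :\: X, forall v, degree X v <= 1}].
  apply: closure_two_neighbours => // Z Z0 cZ; apply: sparse => //.
  exact: leq_trans cX0.
exists X; split=> [|v vYX]; last first.
  split; last exact: low.
  move: vYX; rewrite inE leqNgt => /andP[vX vY]; apply: contra vX => lt.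
  by apply: (subsetP sX0X); rewrite inE vY.
rewrite properEcard sXY (leq_ltn_trans cX) //.
have [lt_Yz|le_Yz] := ltnP z #|Y|; first exact: leq_ltn_trans cX0 lt_Yz.
have := sparse Y Y_n0 le_Yz.
have : s.+1 * #|X0| <= \sum_(w in Y) degree Y w.
  rewrite (big_setID X0) /= (setIidPr sX0Y) mulnC -sum_nat_const.
  apply: leq_trans (leq_addr _ _); apply: leq_sum => v.
  by rewrite inE => /andP[].
have : 13 * #|X0| <= s.+1 * #|X0| by rewrite leq_mul2r ltnS s12 orbT.
have : 0 < #|Y| by rewrite card_gt0.
lia.
Qed.

End Ordering.

(** * Dependent random choice *)

Lemma leq_expl k m n : m <= n -> m ^ k <= n ^ k.
Proof. by case: k => // k le_mn; rewrite leq_exp2r. Qed.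

Lemma sum_card_swap (I J : finType) (P : pred I) (R : I -> J -> bool) :
  \sum_(i | P i) #|[set j | R i j]| = \sum_j #|[set i | P i && R i j]|.
Proof.
under eq_bigr => i _ do rewrite -sum1dep_card.
under [RHS]eq_bigr => j _ do rewrite -sum1dep_card.
by rewrite (exchange_big_dep predT).
Qed.

Section DependentRandomChoice.
Variables (V : finType) (G : rel V).
Hypothesis G_sym : symmetric G.

Let im k (t : {ffun 'I_k -> V}) : {set V} := [set t i | i : 'I_k].
Let nbh (S : {set V}) := common G setT S.

Lemma nbh_swap k (t : {ffun 'I_k -> V}) (S : {set V}) :
  (S \subset nbh (im t)) = (t \in ffun_on (mem (nbh S))).
Proof.
apply/subsetP/ffun_onP => [sub i|sub x xS]; apply/commonP; split; rewrite ?inE //.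
  by move=> x /sub /commonP[_ /(_ (t i))]; rewrite G_sym; apply; apply: imset_f.
by move=> _ /imsetP[i _ ->]; have /commonP[_ /(_ _ xS)] := sub i; rewrite G_sym.
Qed.

Definition bad_pairs (s L : nat) (W : {set V}) :=
  [set p : {ffun 'I_s -> V} * {ffun 'I_s -> V} |
    [&& p.1 \in ffun_on (mem W), p.2 \in ffun_on (mem W)
      & #|nbh (im p.1 :|: im p.2)| < L]].

Lemma card_tuples k (W : {set V}) :
  #|[set t : {ffun 'I_k -> V} | t \in ffun_on (mem W)]| = #|W| ^ k.
Proof.
rewrite -[in RHS](card_ord k) -card_ffun_on.
by apply: eq_card => t; rewrite inE.
Qed.

Lemma ffun_on_im k (t : {ffun 'I_k -> V}) (W : {set V}) :
  (t \in ffun_on (mem W)) = (im t \subset W).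
Proof.
apply/ffun_onP/subsetP => [tW _ /imsetP[i _ ->] //|sub i].
by apply: sub; apply: imset_f.
Qed.

(* [W] is the common neighbourhood of [k] random vertices: a bad pair falls inside
   it with probability at most [2 ^ (- b * k)], whereas [W] itself has expected
   density at least [2 ^ (- k - 1)]. *)
Lemma random_common_nbh (s k b L : nat) : 0 < s -> 0 < #|V| ->
  #|V| <= 2 * #|[set x | #|V| <= 2 * #|nbh [set x]|]| -> 2 ^ b * L = #|V| ->
  exists W : {set V}, #|V| <= 2 ^ k.+2 * #|W| /\
    2 ^ (b * k) * #|bad_pairs s L W| <= 2 ^ k.+2 * #|V| ^ (2 * s).
Proof.
set N := #|V|; set D := [set x | _] => s0 N0 half defL.
pose W (t : {ffun 'I_k -> V}) := nbh (im t).
have cT : #|{: {ffun 'I_k -> V}}| = N ^ k by rewrite card_ffun card_ord.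
(* Counting pairs of [x] and [t] by [x] gives the sum of the [k]-th powers of the degrees, and half
   of the degrees are at least [N / 2]. *)
have sumW : N ^ k.+1 <= 2 ^ k.+1 * \sum_t #|W t|.
  have -> : \sum_t #|W t| = \sum_x #|nbh [set x]| ^ k.
    under eq_bigr => t _ do rewrite -cardsE.
    rewrite sum_card_swap; apply: eq_bigr => x _.
    rewrite -card_tuples; apply: eq_card => t; rewrite !in_set /=.
    by rewrite -nbh_swap sub1set [RHS]in_set inE.
  rewrite (bigID (mem D)) /= expnS (expnS 2) -mulnA.
  apply: (leq_trans (leq_mul half (leqnn _))); rewrite -mulnA leq_mul2l /=.
  apply: (@leq_trans (2 ^ k * \sum_(x in D) #|nbh [set x]| ^ k)).
    rewrite big_distrr /= -sum_nat_const; apply: leq_sum => x.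
    by rewrite inE -expnMn; apply: leq_expl.
  by rewrite leq_mul2l leq_addr orbT.
(* A bad pair lies in [W t] only if all [k] entries of [t] are among its fewer than [L] common
   neighbours. *)
have sumB : 2 ^ (b * k) * \sum_t #|bad_pairs s L (W t)| <= N ^ (2 * s) * N ^ k.
  rewrite sum_card_swap.
  apply: (@leq_trans (2 ^ (b * k) * \sum_(p : {ffun 'I_s -> V} * {ffun 'I_s -> V}) L ^ k)).
    rewrite leq_mul2l; apply/orP; right; apply: leq_sum => p _.
    have [lt|ge] := ltnP #|nbh (im p.1 :|: im p.2)| L; last first.
      rewrite (_ : [set _ | _] = set0) ?cards0 //; apply/setP => t.
      by rewrite in_set0 in_set !andbF.
    apply: (@leq_trans (#|nbh (im p.1 :|: im p.2)| ^ k)); last first.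
      exact/leq_expl/ltnW.
    rewrite -card_tuples; apply: subset_leq_card; apply/subsetP => t.
    rewrite in_set in_set !ffun_on_im => /and4P[_ p1 p2 _].
    by rewrite -ffun_on_im -nbh_swap subUset p1.
  rewrite sum_nat_const card_prod !card_ffun !card_ord -/N mulnCA.
  by rewrite [2 ^ (b * k)]expnM -(expnMn (2 ^ b)) defL mul2n -addnn expnD.
(* One averaged inequality yields both conclusions for the same [t]: each follows by dropping one
   summand on the left. *)
have [t le_t] : exists t, N ^ (2 * s) + 2 ^ (b * k) * #|bad_pairs s L (W t)|
     <= 2 ^ k.+2 * N ^ (2 * s).-1 * #|W t|.
  apply/existsP; apply: contraT; rewrite negb_exists => /forallP lt.
  have : \sum_(t : {ffun 'I_k -> V}) (2 ^ k.+2 * N ^ (2 * s).-1 * #|W t|) <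
         \sum_(t : {ffun 'I_k -> V}) (N ^ (2 * s) + 2 ^ (b * k) * #|bad_pairs s L (W t)|).
    apply: (@leq_trans (\sum_(t : {ffun 'I_k -> V})
                          (2 ^ k.+2 * N ^ (2 * s).-1 * #|W t|).+1)); last first.
      by apply: leq_sum => t _; rewrite ltnNge.
    under [leqRHS]eq_bigr => t _ do rewrite -addn1.
    by rewrite big_split /= sum1_card cT -addn1 leq_add2l expn_gt0 N0.
  rewrite ltnNge => /negP[].
  rewrite -big_distrr /= big_split /= -big_distrr sum_nat_const cT mulnC.
  apply: leq_trans (leq_add (leqnn _) sumB) _.
  have -> : N ^ (2 * s) = N * N ^ (2 * s).-1 by rewrite -expnS prednK ?muln_gt0.
  rewrite addnn -mul2n -[N * _ * _]mulnAC -expnS (expnS 2) -!mulnA leq_mul2l /=.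
  by rewrite [N ^ _ * _ in leqRHS]mulnC mulnA leq_mul2r sumW orbT.
exists (W t).
have s2 : 0 < (2 * s) by rewrite muln_gt0.
have NE : N ^ (2 * s) = N * N ^ (2 * s).-1 by rewrite -expnS prednK.
split.
  have : N * N ^ (2 * s).-1 <= 2 ^ k.+2 * #|W t| * N ^ (2 * s).-1.
    by rewrite -NE mulnAC; apply: leq_trans le_t; rewrite leq_addr.
  by rewrite leq_pmul2r // expn_gt0 N0.
apply: leq_trans (leq_addl _ _) (leq_trans le_t _).
by rewrite NE -mulnA leq_mul2l mulnC leq_mul2r max_card !orbT.
Qed.

Lemma common_nbh (S T : {set V}) : common G (nbh T) S = nbh (T :|: S).
Proof. by rewrite setUC /nbh commonU; apply/setP => y; rewrite !inE andbC. Qed.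

(* With [U] the common neighbourhood of a random tuple [t] in [W], a tuple [u] in
   [W] has few neighbours in [U] only if [(t, u)] is a bad pair. *)
Lemma random_second_side (s L1 L2 g1 g2 : nat) (W : {set V}) :
  2 * #|bad_pairs s L2 W| < g1 * #|W| ^ s ->
  2 * (#|V| ^ s * L1 ^ s) < g2 * #|W| ^ s ->
  exists U : {set V},
    #|[set t : {ffun 'I_s -> V} | (t \in ffun_on (mem W))
        && (#|common G U (im t)| < L2)]| < g1 /\
    #|[set t : {ffun 'I_s -> V} | (t \in ffun_on (mem U))
        && (#|common G W (im t)| < L1)]| < g2.
Proof.
move=> bad1 bad2; pose T : finType := {ffun 'I_s -> V}.
pose c1 (t : T) := #|[set u : T | (u \in ffun_on (mem W))
                       && (#|common G (nbh (im t)) (im u)| < L2)]|.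
pose c2 (t : T) := #|[set u : T | (u \in ffun_on (mem (nbh (im t))))
                       && (#|common G W (im u)| < L1)]|.
pose WT := [set t : T | t \in ffun_on (mem W)].
have cWT : #|WT| = #|W| ^ s by apply: card_tuples.
(* Each count is too large for fewer than half of the tuples in [W], so some tuple makes both
   small. *)
have markov (c : T -> nat) g m : \sum_(t in WT) c t <= m -> 2 * m < g * #|W| ^ s ->
    2 * #|[set t in WT | g <= c t]| < #|W| ^ s.
  move=> sum_c lt_m; have g0 : 0 < g by case: (g) lt_m.
  rewrite -(ltn_pmul2l g0); apply: leq_ltn_trans lt_m.
  rewrite mulnCA leq_mul2l /= mulnC -sum_nat_const; apply: leq_trans sum_c.
  rewrite [leqRHS](bigID (fun t => g <= c t)) /=; apply: leq_trans (leq_addr _ _).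
  rewrite (eq_bigl (fun t => (t \in WT) && (g <= c t))) => [|t]; last by rewrite inE.
  by apply: leq_sum => t /andP[].
have lt1 : 2 * #|[set t in WT | g1 <= c1 t]| < #|W| ^ s.
  apply: markov bad1; under eq_bigr => t _ do rewrite /c1 -sum1dep_card.
  rewrite pair_big_dep /= sum1dep_card; apply: subset_leq_card.
  apply/subsetP => -[t u]; rewrite in_set /= in_set common_nbh => /and3P[tW uW lt].
  by rewrite in_set; apply/and3P.
(* A tuple [u] with fewer than [L1] common neighbours in [W] falls inside the random set only if
   every entry of [t] is one of these. *)
have lt2 : 2 * #|[set t in WT | g2 <= c2 t]| < #|W| ^ s.
  apply: markov bad2; rewrite sum_card_swap.
  apply: (@leq_trans (\sum_(u : T) L1 ^ s)); last first.
    by rewrite sum_nat_const card_ffun card_ord.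
  apply: leq_sum => u _; have [lt|ge] := ltnP #|common G W (im u)| L1; last first.
    by rewrite (_ : [set _ | _] = set0) ?cards0 //; apply/setP => t;
       rewrite in_set0 in_set !andbF.
  apply: leq_trans (leq_expl s (ltnW lt)); rewrite -card_tuples.
  apply: subset_leq_card; apply/subsetP => t; rewrite in_set in_set in_set.
  case/and3P=> tW; rewrite -nbh_swap !ffun_on_im => /subsetP uN _.
  apply/subsetP => y yt; have /commonP[_ uy] := uN y yt; apply/commonP; split=> //.
  by move: tW; rewrite ffun_on_im => /subsetP; apply.
have [t] : exists t, t \in WT :\: ([set t in WT | g1 <= c1 t] :|: [set t in WT | g2 <= c2 t]).
  apply/set0Pn; rewrite -card_gt0 cardsD subn_gt0.
  apply: leq_ltn_trans (subset_leq_card (subsetIr _ _)) _.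
  apply: leq_ltn_trans (leq_card_setU _ _) _; rewrite cWT; lia.
rewrite !inE => /andP[+ tW]; rewrite tW /= negb_or -!ltnNge => /andP[lt_c1 lt_c2].
by exists (nbh (im t)).
Qed.

Variables (H : finType) (e : rel H) (side : H -> bool) (s n : nat).
Hypothesis e_sym : symmetric e.
Hypothesis e_side : forall v w, e v w -> side w = ~~ side v.
Hypothesis e_peel : peelable e s.
Hypothesis s_gt0 : 0 < s.
Hypothesis n_gt0 : 0 < n.
Hypothesis cardH : #|H| <= 2 * n.
Hypothesis cardV : #|V| = 2 ^ (18 * s + 10) * n.
Hypothesis dense : #|V| <= 2 * #|[set x | #|V| <= 2 * #|[set y | G x y]|]|.

(* The first round uses [12 * s] random vertices and the threshold [N / 2 ^ (4 * s + 1)],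
   the second one [s] random vertices. *)
Lemma dense_embedding :
  exists2 f : H -> V, injective f & forall v w, e v w -> G (f v) (f w).
Proof.
have N0 : 0 < #|V| by rewrite cardV muln_gt0 expn_gt0.
have dense' : #|V| <= 2 * #|[set x | #|V| <= 2 * #|nbh [set x]|]|.
  rewrite (_ : [set x | _] = [set x | #|V| <= 2 * #|[set y | G x y]|]) //.
  apply/setP => x; rewrite !inE; congr (_ <= 2 * _); apply: eq_card => y.
  rewrite !inE; apply/forall_inP/idP => [|Gxy z]; first by apply; rewrite inE.
  by rewrite inE => /eqP->.
(* Each [L] is [2 ^ s.+2] times the corresponding [gam]; this factor absorbs [s.+1] atypical sets
   and the vertices of [H]. *)
pose L1 := 2 ^ s.+3 * n; pose L2 := 2 ^ (14 * s + 9) * n.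
pose gam1 := 2 * n; pose gam2 := 2 ^ (13 * s + 7) * n.
have defL2 : 2 ^ (4 * s + 1) * L2 = #|V|.
  by rewrite cardV /L2 mulnA -expnD; congr (2 ^ _ * _); lia.
have [W [bigW badW]] := random_common_nbh (12 * s) s_gt0 N0 dense' defL2.
have expn2_gt0 k : 0 < 2 ^ k by rewrite expn_gt0.
have bad1 : 2 * #|bad_pairs s L2 W| < gam1 ^ s * #|W| ^ s.
  rewrite -(ltn_pmul2l (expn2_gt0 ((4 * s + 1) * (12 * s)))) mulnCA.
  apply: (@leq_ltn_trans (2 * (2 ^ (12 * s).+2 * #|V| ^ (2 * s)))).
    by rewrite leq_mul2l badW.
  have le_V : #|V| ^ (2 * s) <= 2 ^ ((18 * s + 9) * s + (12 * s).+2 * s) * (gam1 ^ s * #|W| ^ s).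
    rewrite mul2n -addnn expnD [2 ^ (_ + _)]expnD mulnACA; apply: leq_mul.
      rewrite expnM -expnMn leq_expl // cardV mulnA -expnSr.
      by rewrite addnS.
    by rewrite expnM -expnMn leq_expl.
  rewrite mulnA -expnS; apply: (leq_ltn_trans (leq_mul (leqnn _) le_V)).
  rewrite mulnA -expnD ltn_pmul2r ?ltn_exp2l //; first by nia.
  rewrite muln_gt0 !expn_gt0 muln_gt0 n_gt0 /=.
  by case: (#|W|) bigW; rewrite ?muln0 //; lia.
have bad2 : 2 * (#|V| ^ s * L1 ^ s) < gam2 ^ s * #|W| ^ s.
  apply: (@leq_ltn_trans (2 * ((2 ^ (12 * s).+2 * #|W|) ^ s * L1 ^ s))).
    by rewrite leq_mul2l leq_mul2r leq_expl ?orbT.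
  rewrite /L1 /gam2 (expnMn (2 ^ _.+2)) (expnMn (2 ^ s.+3)) (expnMn (2 ^ _)).
  rewrite mulnACA -!expnM -expnD mulnA -expnS.
  rewrite -[leqRHS]mulnA [n ^ s * _]mulnC ltn_pmul2r ?ltn_exp2l //; first by nia.
  rewrite muln_gt0 !expn_gt0 n_gt0 /= andbT.
  by case: (#|W|) bigW; rewrite ?muln0 //; lia.
have [U [ltW ltU]] := random_second_side bad1 bad2.
pose UU b := if b then W else U.
pose lam b := if b then L1 else L2.
pose gam b := if b then gam1 else gam2.
have bigW' : 2 ^ (6 * s + 8) * n <= #|W|.
  rewrite -(leq_pmul2l (expn2_gt0 (12 * s).+2)); apply: leq_trans bigW.
  by rewrite cardV mulnA -expnD leq_mul2r leq_exp2l //; lia.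
have s_exp : s < 2 ^ s by apply: ltn_expl.
(* Were [U] smaller than [L2], every tuple in [W] would be bad. *)
have L2U : L2 <= #|U|.
  rewrite leqNgt; apply/negP => ltUL; move: ltW; rewrite ltnNge => /negP[].
  apply: (@leq_trans (#|W| ^ s)).
    apply: leq_expl; apply: leq_trans bigW'; rewrite leq_mul2r.
    by rewrite (leq_exp2l 1) ?orbT //; lia.
  rewrite -card_tuples; apply: subset_leq_card; apply/subsetP => t.
  rewrite in_set => tW; rewrite in_set tW /=.
  by apply: leq_ltn_trans ltUL; apply/subset_leq_card/common_sub.
have room b : #|H| + s.+1 * gam b < lam b.
  apply: leq_ltn_trans (leq_add cardH (leqnn _)) _.
  case: b; rewrite /gam /lam.
    have : s.+1 * n <= 2 ^ s * n by rewrite leq_mul2r s_exp orbT.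
    rewrite /L1 /gam1 !expnS; move: (2 ^ s) s_exp => E sE; lia.
  have ->: L2 = 2 ^ s.+2 * gam2.
    by rewrite /L2 /gam2 mulnA -expnD; congr (2 ^ _ * _); lia.
  have : 2 * n <= gam2 by rewrite /gam2 leq_mul2r (leq_exp2l 1) ?orbT //; lia.
  have : s.+1 * gam2 <= 2 ^ s * gam2 by rewrite leq_mul2r s_exp orbT.
  have : 0 < 2 ^ s * gam2 by rewrite !muln_gt0 !expn_gt0 n_gt0.
  rewrite !expnS; move: (2 ^ s) (gam2) s_exp => E g sE; lia.
have lamU b : lam b <= #|UU b|.
  case: b; rewrite /lam /UU // (leq_trans _ bigW') // leq_mul2r leq_exp2l // orbC.
  by rewrite -addn3 leq_add // leq_pmull.
have gamU b : gam b < #|UU b|.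
  apply: leq_trans (lamU b); apply: leq_ltn_trans _ (room b).
  by rewrite (@leq_trans (s.+1 * gam b)) ?leq_addl // leq_pmull.
have [r [r_inj r1 r2]] := degree_ordering e_sym e_peel.
apply: (embedding gamU G_sym e_sym e_side r_inj r1 r2 s_gt0 _ room) => b.
apply: contraT => /bad_tuples_ge; rewrite leqNgt => /negP[].
apply: (@leq_trans (gam b ^ s)); last exact/leq_expl/leqnSn.
case: b; rewrite /bad_tuples /=.
  apply: leq_ltn_trans ltW; apply: subset_leq_card; apply/subsetP => t.
  by rewrite !in_set set0U.
apply: leq_ltn_trans ltU; apply: subset_leq_card; apply/subsetP => t.
by rewrite !in_set set0U.
Qed.

End DependentRandomChoice.

(** * Deterministic Ramsey bounds *)

Lemma ramsey_leq (H : sgraph) N : ramsey_arrow H N -> ramsey H <= N.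
Proof. by rewrite /ramsey; case: ex_minnP => m _; apply. Qed.

Lemma ramsey_arrowP (H : sgraph) : ramsey_arrow H (ramsey H).
Proof. by rewrite /ramsey; case: ex_minnP. Qed.

Lemma ramsey_upper n s (E : {set 'I_n * 'I_n}) :
  0 < n -> 0 < s -> peelable (bip_edge E) s ->
  ramsey (bip_graph E) <= 2 ^ (18 * s + 10) * n.
Proof.
move=> n0 s0 peel; apply: ramsey_leq; set N := _ * n.
have N0 : 0 < N by rewrite muln_gt0 expn_gt0.
rewrite /ramsey_arrow N0; apply/forallP => c.
pose G b : rel 'I_N := fun x y => c [set x; y] == b.
pose D b := [set x | N <= 2 * #|[set y | G b x y]|].
have [b half] : exists b, N <= 2 * #|D b|.
  have : #|[set: 'I_N]| <= #|D true| + #|D false|.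
    apply: leq_trans (leq_card_setU _ _); apply: subset_leq_card.
    apply/subsetP => x _; rewrite !inE.
    (* The loop at [x], coloured by the value of [c] on a singleton, is counted too, so the two
       degrees add up to exactly [N]. *)
    have : #|[set y | G true x y]| + #|[set y | G false x y]| = N.
      rewrite -[RHS]card_ord -[RHS](cardC [set y | G true x y]); congr (_ + _).
      by apply: eq_card => y; rewrite !inE /G; case: (c _).
    by lia.
  rewrite cardsT card_ord => le_N.
  have [?|?] := leqP N (2 * #|D true|); first by exists true.
  by exists false; lia.
have [f f_inj fG] : exists2 f : bip_graph E -> 'I_N,
    injective f & forall v w, bip_edge E v w -> G b (f v) (f w).
  apply: (@dense_embedding _ _ _ _ _ (fun v => if v is inl _ then true else false) s n) => //.
  - by move=> x y; rewrite /G setUC.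
  - exact: bip_edge_sym.
  - by move=> [i|i] [j|j].
  - by rewrite card_sum card_ord addnn mul2n.
  - by rewrite card_ord.
  - by rewrite card_ord.
apply/existsP; exists b; apply/existsP; exists [ffun v => f v]; apply/andP; split.
  by apply/injectiveP => x y; rewrite !ffunE; apply: f_inj.
apply/forallP => x; apply/forallP => y; apply/implyP => exy.
by rewrite !ffunE; apply: fG.
Qed.

Lemma ramsey_geq_card (H : sgraph) : #|H| <= ramsey H.
Proof.
have /andP[_ /forallP/(_ [ffun=> true])] := ramsey_arrowP H.
case/existsP=> b /existsP[f /andP[/injectiveP f_inj _]].
by have := leq_card _ f_inj; rewrite card_ord.
Qed.

(** * Lindsey's inequality over F_2^t *)

Section InnerProduct.
Local Open Scope ring_scope.
Variables (t n K : nat) (g h : 'I_n -> {set 'I_t}).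
Hypothesis g_fib : forall v, (#|[set i | g i == v]| <= K)%N.
Hypothesis h_fib : forall v, (#|[set i | h i == v]| <= K)%N.

(** The characters of F_2^t, with subsets as vectors. *)
Let chi (v a : {set 'I_t}) : int := (-1) ^+ #|v :&: a|.

(** The sum factors over coordinates, and a coordinate where [a] and [b] differ contributes
    [-1 + 1]. *)
Lemma chi_orthogonal a b :
  \sum_v chi v a * chi v b = if a == b then (2 ^ t)%N%:Z else 0.
Proof.
pose x (a : {set 'I_t}) i : int := if i \in a then -1 else 1.
have chiE v c : chi v c = \prod_(i in v) x c i.
  rewrite /chi -prodr_const big_mkcond [RHS]big_mkcond; apply: eq_bigr => i _.
  by rewrite inE /x; case: (i \in v) => /=.
have -> : \sum_v chi v a * chi v b = \prod_i (x a i * x b i + 1).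
  rewrite bigA_distr; apply: eq_bigr => v _.
  by rewrite !chiE -big_split big_mkcond /=.
case: eqP => [->|/eqP neq_ab].
  rewrite (eq_bigr (fun=> 2%:Z)) => [|i _]; last by rewrite /x; case: ifP.
  by rewrite prodr_const card_ord -[RHS]natz natrX.
have [i neq_i] : exists i, (i \in a) != (i \in b).
  apply/existsP; apply: contraNT neq_ab; rewrite negb_exists => /forallP eq_ab.
  by apply/eqP/setP => i; apply/eqP; rewrite -[_ == _]negbK eq_ab.
rewrite (bigD1 i) //= /x; move: neq_i.
by do 2 case: ifP => //; rewrite ?(mulr1, mul1r) addNr mul0r.
Qed.

Lemma sqr_sum_le (I : finType) (a : I -> int) :
  (\sum_i a i) ^+ 2 <= #|I|%:Z * \sum_i a i ^+ 2.
Proof.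
have : 0 <= \sum_i \sum_j (a i - a j) ^+ 2.
  by apply: sumr_ge0 => i _; apply: sumr_ge0 => j _; apply: sqr_ge0.
pose s1 := \sum_i a i; pose s2 := \sum_i a i ^+ 2; pose m : int := #|I|%:R.
have sqr_diff i : \sum_j (a i - a j) ^+ 2 = m * a i ^+ 2 - 2 * s1 * a i + s2.
  have sqrE j : (a i - a j) ^+ 2 = a i ^+ 2 - 2 * a i * a j + a j ^+ 2 by ring.
  under eq_bigr => j _ do rewrite sqrE.
  rewrite big_split sumrB /= sumr_const -mulr_sumr -/s1 -/s2 -[_ *+ #|_|]mulr_natl.
  rewrite -/m; ring.
under eq_bigr => i _ do rewrite sqr_diff.
rewrite big_split sumrB /= sumr_const -!mulr_sumr -[_ *+ #|_|]mulr_natl -natz.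
by rewrite -/s1 -/s2 -/m => ?; nra.
Qed.

(* Lindsey: S^2 <= (n K)^2 2^t for the sum S of all the signs. *)
Lemma inner_product_balanced : (4 * K ^ 2 * 2 ^ t <= n ^ 2)%N -> forall b,
  (n ^ 2 <= 4 * #|[set p | odd #|g p.1 :&: h p.2| == b]|)%N.
Proof.
move=> small.
pose S := \sum_i \sum_j chi (g i) (h j).
(* After Cauchy-Schwarz over the rows, at most [K] rows share a label [v]. Summing over all [v]
   makes orthogonality available, which keeps only the pairs of columns with equal labels. *)
have S2 : S ^+ 2 <= (n ^ 2 * (K ^ 2 * 2 ^ t))%N%:Z.
  apply: le_trans (sqr_sum_le _) _; rewrite card_ord.
  pose F v := (\sum_j chi v (h j)) ^+ 2.
  have F0 v : 0 <= F v by apply: sqr_ge0.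
  have -> : \sum_i (\sum_j chi (g i) (h j)) ^+ 2 = \sum_v #|[set i | g i == v]|%:Z * F v.
    rewrite (partition_big g predT) //=; apply: eq_bigr => v _.
    rewrite (eq_bigr (fun=> F v)) => [|i /eqP-> //].
    rewrite sumr_const -mulr_natl natz; congr (_%:Z * _).
    by apply: eq_card => i; rewrite !inE.
  apply: (@le_trans _ _ (n%:Z * \sum_v K%:Z * F v)).
    apply: ler_wpM2l => //; apply: ler_sum => v _; apply: ler_wpM2r => //.
    by rewrite lez_nat.
  rewrite -mulr_sumr.
  have -> : \sum_v F v = \sum_j #|[set j' | h j' == h j]|%:Z * (2 ^ t)%N%:Z.
    rewrite /F; under eq_bigr => v _ do rewrite expr2 mulr_suml.
    rewrite exchange_big /=; apply: eq_bigr => j _.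
    under eq_bigr => v _ do rewrite mulr_sumr.
    rewrite exchange_big /=; under eq_bigr => j' _ do rewrite chi_orthogonal.
    rewrite -big_mkcond sumr_const -mulr_natl natz; congr (_%:Z * _).
    by apply: eq_card => j'; rewrite !inE eq_sym.
  have le_sum : \sum_j #|[set j' | h j' == h j]|%:Z * (2 ^ t)%N%:Z
      <= \sum_(j < n) K%:Z * (2 ^ t)%N%:Z.
    by apply: ler_sum => j _; apply: ler_wpM2r; rewrite ?lez_nat.
  apply: le_trans (ler_wpM2l _ (ler_wpM2l _ le_sum)) _ => //.
  rewrite sumr_const card_ord -mulr_natl natz -!PoszM lez_nat; nia.
pose A b := [set p : 'I_n * 'I_n | odd #|g p.1 :&: h p.2| == b].
have SE : S = #|A false|%:Z - #|A true|%:Z.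
  rewrite /S pair_big /= (bigID (fun p => odd #|g p.1 :&: h p.2| == false)) /=.
  rewrite (eq_bigr (fun=> 1)) => [|p]; last first.
    by rewrite /chi -signr_odd => /eqP->.
  rewrite [X in _ + X](eq_bigr (fun=> -1)) => [|p]; last first.
    by rewrite /chi -signr_odd eqbF_neg negbK => ->.
  rewrite sumrN !sumr_const -!natz; congr (_%:R - _%:R); apply: eq_card => p.
    by rewrite !inE.
  by rewrite inE /in_mem /=; case: (odd _).
have cA : (#|A false| + #|A true| = n ^ 2)%N.
  have <- : #|{: 'I_n * 'I_n}| = (n ^ 2)%N by rewrite card_prod card_ord mulnn.
  rewrite -(cardC (A false)); congr (_ + _)%N; apply: eq_card => p.
  by rewrite !inE; case: (odd _).
move: S2; rewrite SE => S2 b; suff : (n ^ 2 <= 4 * #|A b|)%N by [].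
have {}S2 : (2 * (#|A false|%:Z - #|A true|%:Z)) ^+ 2 <= (n%:Z ^+ 2) ^+ 2.
  rewrite exprMn; apply: le_trans (ler_wpM2l _ S2) _ => //.
  rewrite -!natz -!natrX -natrM ler_nat; nia.
have cAz : #|A false|%:Z + #|A true|%:Z = n%:Z ^+ 2.
  by rewrite -PoszD cA -!natz natrX.
rewrite -cAz in S2; rewrite -cA -/(A b).
(* The two classes differ by at most half of their total, so neither exceeds three times the
   other. *)
have sqr_le (x y : int) : 0 <= x -> 0 <= y -> (2 * (x - y)) ^+ 2 <= (x + y) ^+ 2 ->
    x <= 3 * y.
  move=> x0 y0 le_xy; rewrite leNgt; apply/negP => lt; nra.
have le1 : #|A false|%:Z <= 3 * #|A true|%:Z by apply: sqr_le.
have le2 : #|A true|%:Z <= 3 * #|A false|%:Z.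
  by apply: sqr_le => //; move: S2; rewrite !expr2; lra.
by case: b; lia.
Qed.

End InnerProduct.

(** * Block colourings *)

Section LowerBound.
Variables (t n K : nat) (E : {set 'I_n * 'I_n}).

Definition low_fibres (f : {ffun 'I_n + 'I_n -> {set 'I_t}}) :=
  [forall v, (#|[set i | f (inl i) == v]| <= K) && (#|[set i | f (inr i) == v]| <= K)].

Definition monochromatic_map b (f : {ffun 'I_n + 'I_n -> {set 'I_t}}) :=
  [set p | odd #|f (inl p.1) :&: f (inr p.2)| == b].

(** What remains of a monochromatic copy when only the block labels of its vertices are kept; the
    number of such maps does not depend on [N]. *)
Definition has_block_map :=
  [exists x : bool * {ffun 'I_n + 'I_n -> {set 'I_t}},
    low_fibres x.2 && (E \subset monochromatic_map x.1 x.2)].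

Lemma block_colouring N : N <= K * 2 ^ t -> ramsey_arrow (bip_graph E) N ->
  has_block_map.
Proof.
move=> leN /andP[N0 /forallP arrow].
have K0 : 0 < K by case: (K) leN; rewrite // leqNgt N0.
(* Blocks of [K] consecutive vertices; the index stays below [2 ^ t], so the default is never
   reached. *)
pose P (u : 'I_N) := nth set0 (enum [set: {set 'I_t}]) (u %/ K).
have size_enum : size (enum [set: {set 'I_t}]) = 2 ^ t.
  by rewrite -cardE -powersetT card_powerset cardsT card_ord.
have lt_div (u : 'I_N) : u %/ K < 2 ^ t.
  by rewrite ltn_divLR // mulnC; apply: leq_trans leN.
have PK v : #|[set u | P u == v]| <= K.
  rewrite -[leqRHS]card_ord -[X in _ <= X]cardsT.
  have inj : {in [set u | P u == v] &, injective (fun u : 'I_N => Ordinal (ltn_pmod u K0))}.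
    move=> u w; rewrite !inE => /eqP Pu /eqP Pw [eq_mod].
    apply: val_inj; rewrite /= (divn_eq u K) (divn_eq w K) eq_mod; congr (_ * _ + _).
    move: (etrans Pu (esym Pw)) => /eqP; rewrite nth_uniq ?size_enum ?enum_uniq //.
    by move/eqP.
  by rewrite -(card_in_imset inj); apply/subset_leq_card/subsetT.
pose c := [ffun A : {set 'I_N} =>
  [exists u in A, exists w in A, (u != w) && odd #|P u :&: P w|]].
have cE u w : u != w -> c [set u; w] = odd #|P u :&: P w|.
  move=> neq_uw; rewrite ffunE; apply/exists_inP/idP => [[x xA]|odd_uw].
    case/exists_inP=> y yA; move: xA yA; rewrite !inE.
    by move=> /orP[]/eqP-> /orP[]/eqP->; rewrite ?eqxx // setIC => /andP[].
  exists u; rewrite ?inE ?eqxx //; apply/exists_inP; exists w; last by rewrite neq_uw.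
  by rewrite !inE eqxx orbT.
have /existsP[b /existsP[f /andP[/injectiveP f_inj /forallP mono]]] := arrow c.
apply/existsP; exists (b, [ffun x => P (f x)]); apply/andP; split=> /=.
  apply/forallP => v; apply/andP; split; apply: leq_trans (PK v).
    rewrite -(card_imset [set i | _] (inj_comp f_inj (@inl_inj _ _))).
    apply: subset_leq_card; apply/subsetP => _ /imsetP[i + ->].
    by rewrite !inE ffunE.
  rewrite -(card_imset [set i | _] (inj_comp f_inj (@inr_inj _ _))).
  apply: subset_leq_card; apply/subsetP => _ /imsetP[i + ->].
  by rewrite !inE ffunE.
apply/subsetP => -[i j] ijE; rewrite inE !ffunE /=.
have /forallP/(_ (inr j))/implyP/(_ ijE) := mono (inl i).
by rewrite cE ?(inj_eq f_inj).
Qed.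

End LowerBound.

(** * Edge counts that ensure peelability *)

Definition inner_pairs n (Z : {set 'I_n + 'I_n}) : {set 'I_n * 'I_n} :=
  [set p | (inl p.1 \in Z) && (inr p.2 \in Z)].

Lemma card_inner_pairs n (Z : {set 'I_n + 'I_n}) : #|inner_pairs Z| <= #|Z| * #|Z|.
Proof.
pose f (p : 'I_n * 'I_n) : ('I_n + 'I_n) * ('I_n + 'I_n) := (inl p.1, inr p.2).
have f_inj : injective f by move=> [i j] [i' j'] [-> ->].
rewrite -(card_imset _ f_inj) -cardsX; apply/subset_leq_card/subsetP => q.
by case/imsetP=> ij + ->; rewrite !inE.
Qed.

Section BipartiteDegrees.
Variables (n : nat) (E : {set 'I_n * 'I_n}).
Implicit Types Z : {set 'I_n + 'I_n}.

Lemma degree_inl Z i :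
  degree (bip_edge E) Z (inl i) = \sum_j ((inr j \in Z) && ((i, j) \in E)).
Proof.
rewrite /degree -sum1dep_card big_mkcond big_sumType /= big1 => [|j _]; last first.
  by rewrite andbF.
by apply: eq_bigr => j _; case: ifP.
Qed.

Lemma degree_inr Z j :
  degree (bip_edge E) Z (inr j) = \sum_i ((inl i \in Z) && ((i, j) \in E)).
Proof.
rewrite /degree -sum1dep_card big_mkcond big_sumType /= [X in _ + X]big1 => [|i _]; last first.
  by rewrite andbF.
by rewrite addn0; apply: eq_bigr => i _; case: ifP.
Qed.

Lemma card_pairs (F : {set 'I_n * 'I_n}) :
  #|F| = \sum_i \sum_j ((i, j) \in F).
Proof.
rewrite pair_big -sum1_card big_mkcond /=.
by apply: eq_bigr => -[i j] _ /=; case: ifP.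
Qed.

Lemma sum_degree_inner Z :
  \sum_(w in Z) degree (bip_edge E) Z w = 2 * #|E :&: inner_pairs Z|.
Proof.
rewrite big_mkcond big_sumType /= mul2n -addnn card_pairs.
congr (_ + _); last rewrite exchange_big /=; apply: eq_bigr => i _.
  rewrite degree_inl; case: ifP => iZ; last first.
    by rewrite big1 // => j _; rewrite !inE /= iZ andbF.
  by apply: eq_bigr => j _; rewrite !inE /= iZ andbC.
rewrite degree_inr; case: ifP => iZ; last first.
  by rewrite big1 // => j _; rewrite !inE /= iZ !andbF.
by apply: eq_bigr => j _; rewrite !inE /= iZ andbT andbC.
Qed.

(** Working on one side of the bipartition counts every edge at [L] once, so no factor 2 is lost.
    The parameters [side] and [fam] let one argument serve both sides. *)
Lemma high_degree_set s x (T : {set 'I_n + 'I_n}) (side : 'I_n -> 'I_n + 'I_n)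
    (fam : {set 'I_n} -> {set 'I_n * 'I_n}) :
  {in T, forall v, s < degree (bip_edge E) setT v} ->
  (forall L : {set 'I_n}, \sum_(i in L) degree (bip_edge E) setT (side i) = #|E :&: fam L|) ->
  x <= #|[set i | side i \in T]| ->
  exists L : {set 'I_n}, (#|L| == x) && (s * x <= #|E :&: fam L|).
Proof.
move=> highT famE le_x.
have [L] : exists L : {set 'I_n}, L \in [set L : {set 'I_n} |
    L \subset [set i | side i \in T] & #|L| == x].
  by apply/set0Pn; rewrite -card_gt0 cards_draws bin_gt0.
rewrite inE => /andP[/subsetP sLT cL]; exists L; rewrite cL -famE.
rewrite mulnC -(eqP cL) -sum_nat_const; apply: leq_sum => i /sLT.
by rewrite inE => /highT /ltnW.
Qed.

Lemma few_high_degree s x :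
  ~~ [exists L : {set 'I_n}, (#|L| == x) && (s * x <= #|E :&: setX L setT|)] ->
  ~~ [exists L : {set 'I_n}, (#|L| == x) && (s * x <= #|E :&: setX setT L|)] ->
  #|[set v | s < degree (bip_edge E) setT v]| <= 2 * x.
Proof.
set T := [set v | _] => /existsPn noL /existsPn noR.
have highT : {in T, forall v, s < degree (bip_edge E) setT v}.
  by move=> v; rewrite inE.
have cT : #|T| = #|[set i | inl i \in T]| + #|[set i | inr i \in T]|.
  rewrite -sum1_card big_mkcond big_sumType -!big_mkcond /= -!sum1dep_card.
  by congr (_ + _); apply: eq_bigl => i.
rewrite cT mul2n -addnn; apply: leq_add; rewrite leqNgt; apply/negP => /ltnW le_x.
  case: (high_degree_set highT _ le_x (fam := fun L => setX L setT)) => [L|L LP].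
    rewrite card_pairs big_mkcond; apply: eq_bigr => i _; case: ifP => iL; last first.
      by rewrite big1 // => j _; rewrite !inE /= iL /= andbF.
    by rewrite degree_inl; apply: eq_bigr => j _; rewrite !inE /= iL /= andbT.
  by have := noL L; rewrite LP.
case: (high_degree_set highT _ le_x (fam := fun L => setX setT L)) => [L|L LP].
  rewrite card_pairs exchange_big big_mkcond; apply: eq_bigr => i _; case: ifP => iL; last first.
    by rewrite big1 // => j _; rewrite !inE /= iL /= andbF.
  by rewrite degree_inr; apply: eq_bigr => j _; rewrite !inE /= iL /= andbT.
by have := noR L; rewrite LP.
Qed.

(** Exceptional events suited to a union bound: each asks for many edges among the pairs attached to
    a vertex set. In the last one the set has average degree at least 3. *)
Definition irregular s x : bool :=
  [|| [exists L : {set 'I_n}, (#|L| == x) && (s * x <= #|E :&: setX L setT|)],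
      [exists L : {set 'I_n}, (#|L| == x) && (s * x <= #|E :&: setX setT L|)]
    | [exists Z : {set 'I_n + 'I_n},
         [&& 0 < #|Z|, #|Z| <= 8 * x & 3 * #|Z| <= 2 * #|E :&: inner_pairs Z|]]].

Lemma regular_peelable s x : 12 <= s -> ~~ irregular s x -> peelable (bip_edge E) s.
Proof.
move=> s12; rewrite !negb_or => /and3P[left right /existsPn sparse].
(* At most [2 * x] vertices have high degree, and the closure may quadruple their number. *)
apply: (sparse_peelable (bip_edge_sym E) (z := 8 * x)) => // [|Z Z0 cZ].
  by have := few_high_degree left right; lia.
have := sparse Z; rewrite card_gt0 Z0 cZ /= -ltnNge -sum_degree_inner; exact.
Qed.

End BipartiteDegrees.

(** * The random bipartite graph *)

Lemma bin_expn_le m k : 'C(m, k) * k ^ k <= (4 * m) ^ k.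
Proof.
(* The falling factorial of [2 * k] of length [k] is at least [k ^ k]; it is also the factorial of
   [k] times a binomial coefficient of at most [4 ^ k]. *)
have kk : k ^ k <= 4 ^ k * k`!.
  apply: (@leq_trans ((2 * k) ^_ k)).
    rewrite ffact_prod -[k in k ^ _](subnK (leqnn k)) subnn add0n.
    rewrite -[in X in _ ^ X](card_ord k) -prod_nat_const; apply: leq_prod => i _.
    by have := ltn_ord i; lia.
  rewrite -bin_ffact leq_mul2r; apply/orP; right.
  rewrite -[4]/(2 ^ 2)%N -expnM; apply: (@leq_trans #|[set: {set 'I_(2 * k)}]|).
    rewrite -[in 'C(_, _)](card_ord (2 * k)) -card_draws.
    by apply/subset_leq_card/subsetT.
  by rewrite -powersetT card_powerset cardsT card_ord.
apply: (leq_trans (leq_mul (leqnn _) kk)).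
rewrite mulnCA bin_ffact expnMn leq_mul2l; apply/orP; right.
rewrite ffact_prod -[in leqRHS](card_ord k) -prod_nat_const.
by apply: leq_prod => i _; apply: leq_subr.
Qed.

Local Open Scope ring_scope.

Lemma bin_le_expr (R : realFieldType) m k : (0 < k)%N ->
  'C(m, k)%:R <= (4 * m%:R / k%:R) ^+ k :> R.
Proof.
move=> k0; rewrite exprMn exprVn ler_pdivlMr ?exprn_gt0 ?ltr0n //.
by rewrite -!natrX -!natrM -natrX ler_nat bin_expn_le.
Qed.

Section RandomEdges.
Variables (R : realType) (n : nat) (p : R).
Local Notation pairs := ('I_n * 'I_n)%type.
Implicit Types (E M K F : {set pairs}) (A B : pred {set pairs}).

Definition Pr A : R := \sum_(E | A E) Gnnp_weight p E.

Lemma Pr_total : Pr predT = 1.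
Proof.
rewrite /Pr /Gnnp_weight -(bigA_distr _ _ (fun=> p) (fun=> 1 - p)) /=.
by rewrite big1 // => i _; rewrite addrC subrK.
Qed.

Lemma Pr_sub M : Pr (fun E => E \subset M) = (1 - p) ^+ #|~: M|.
Proof.
transitivity (\prod_i ((if i \in M then p else 0) + (1 - p))).
  rewrite bigA_distr /Pr big_mkcond; apply: eq_bigr => E _.
  case: ifPn => [/subsetP sEM|/subsetPn[i iE iM]].
    by apply: eq_bigr => i _; case: ifP => // /sEM->.
  by apply/esym/eqP; rewrite prodf_seq_eq0; apply/hasP; exists i;
     rewrite ?mem_index_enum //= iE (negPf iM).
rewrite -prodr_const [RHS]big_mkcond; apply: eq_bigr => i _.
by rewrite inE; case: (i \in M) => /=; [rewrite addrC subrK | rewrite add0r].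
Qed.

Lemma Pr_sup K : Pr (fun E => K \subset E) = p ^+ #|K|.
Proof.
transitivity (\prod_i (p + (if i \in K then 0 else 1 - p))).
  rewrite bigA_distr /Pr big_mkcond; apply: eq_bigr => E _.
  case: ifPn => [/subsetP sKE|/subsetPn[i iK iE]].
    apply: eq_bigr => i _; case: ifPn => // iE; rewrite ifN //.
    by apply: contra iE => /sKE.
  by apply/esym/eqP; rewrite prodf_seq_eq0; apply/hasP; exists i;
     rewrite ?mem_index_enum //= iK (negPf iE).
rewrite -prodr_const [RHS]big_mkcond; apply: eq_bigr => i _.
by case: (i \in K) => /=; [rewrite addr0 | rewrite addrC subrK].
Qed.

Hypothesis p01 : 0 <= p <= 1.

Lemma weight_ge0 E : 0 <= Gnnp_weight p E.
Proof.
by apply: prodr_ge0 => e _; case: ifP; case/andP: p01; rewrite ?subr_ge0.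
Qed.

Lemma Pr_ge0 A : 0 <= Pr A.
Proof. by apply: sumr_ge0 => E _; apply: weight_ge0. Qed.

Lemma Pr_le A B : subpred A B -> Pr A <= Pr B.
Proof.
move=> AB; rewrite /Pr big_mkcond [leRHS]big_mkcond; apply: ler_sum => E _.
case: ifP => [/AB->//|_]; case: ifP => _ //; exact: weight_ge0.
Qed.

Lemma Pr_exists (I : finType) (D : pred I) (A : I -> pred {set pairs}) :
  Pr (fun E => [exists i in D, A i E]) <= \sum_(i in D) Pr (A i).
Proof.
rewrite /Pr (exchange_big_dep predT) //= big_mkcond; apply: ler_sum => E _.
case: ifPn => [/exists_inP[i iD AiE]|_]; last first.
  by apply: sumr_ge0 => i _; apply: weight_ge0.
rewrite (bigD1 i) /=; last exact/andP.
by rewrite lerDl; apply: sumr_ge0 => j _; apply: weight_ge0.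
Qed.

Lemma Pr_setU A B : Pr (fun E => A E || B E) <= Pr A + Pr B.
Proof.
rewrite /Pr big_mkcond [X in _ <= X + _]big_mkcond [X in _ <= _ + X]big_mkcond.
rewrite -big_split; apply: ler_sum => E _ /=.
by have := weight_ge0 E; case: (A E); case: (B E) => /=; lra.
Qed.

Lemma Pr_many F k : Pr (fun E => k <= #|E :&: F|)%N <= 'C(#|F|, k)%:R * p ^+ k.
Proof.
rewrite -cards_draws.
pose D := [set K : {set pairs} | K \subset F & #|K| == k].
apply: (@le_trans _ _ (Pr (fun E => [exists K in D, K \subset E]))).
  apply: Pr_le => E le_k.
  have [K] : exists K : {set pairs}, K \in [set K : {set pairs} | K \subset E :&: F & #|K| == k].
    by apply/set0Pn; rewrite -card_gt0 cards_draws bin_gt0.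
  rewrite inE subsetI => /andP[/andP[KE KF] cK].
  by apply/exists_inP; exists K; rewrite ?inE ?KF.
apply: (le_trans (Pr_exists _ _)).
rewrite (eq_bigr (fun=> p ^+ k)) => [|K]; last first.
  by rewrite inE Pr_sup => /andP[_ /eqP->].
by rewrite sumr_const -[leLHS]mulr_natl.
Qed.

Variables (D : nat).
Hypothesis n_gt0 : (0 < n)%N.
Hypothesis D_gt0 : (0 < D)%N.
Hypothesis p_le : p <= D%:R / n%:R.

Let n0 : 0 < n%:R :> R. Proof. by rewrite ltr0n. Qed.
Let s := (64 * D)%N.

Let Pr_many_le F k : Pr (fun E => k <= #|E :&: F|)%N
  <= 'C(#|F|, k)%:R * (D%:R / n%:R) ^+ k.
Proof.
apply: le_trans (Pr_many F k) _; apply: ler_wpM2l => //.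
by case/andP: p01 => p0 _; rewrite lerXn2r ?nnegrE // (le_trans p0).
Qed.

(** As [s = 64 * D], a fixed [L] has probability at most [16 ^ (- s * x)], against at most
    [(8 * 2 ^ s) ^ x] choices of [L]. At most [2 ^ (- x)] is left, and [x < 2 ^ x] turns this into a
    bound of order [1 / n]. *)
Lemma Pr_many_high (fam : {set 'I_n} -> {set pairs}) (x : nat) :
  (forall L, #|fam L| = #|L| * n)%N -> (0 < x)%N -> (n <= x * 2 ^ s.+1)%N ->
  Pr (fun E => [exists L : {set 'I_n}, (#|L| == x) && (s * x <= #|E :&: fam L|)%N])
    <= (2 ^ s.+1)%:R / n%:R.
Proof.
move=> c_fam x0 le_n.
have x0R : 0 < x%:R :> R by rewrite ltr0n.
have s0 : (0 < s)%N by rewrite muln_gt0.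
pose DL := [set L : {set 'I_n} | #|L| == x].
apply: (@le_trans _ _ (Pr (fun E => [exists L in DL, s * x <= #|E :&: fam L|]%N))).
  by apply: Pr_le => E /existsP[L LP]; apply/existsP; exists L; rewrite inE.
apply: (le_trans (Pr_exists _ _)).
apply: (@le_trans _ _ (\sum_(L in DL) (1 / 16) ^+ (s * x))).
  apply: ler_sum => L; rewrite inE => /eqP cL.
  apply: (le_trans (Pr_many_le _ _)); rewrite c_fam cL.
  have sx0 : (0 < s * x)%N by rewrite muln_gt0 s0.
  apply: le_trans (ler_wpM2r _ (bin_le_expr R _ sx0)) _.
    by rewrite exprn_ge0 // divr_ge0.
  rewrite -exprMn; apply: lerXn2r; rewrite ?nnegrE.
  - by rewrite !mulr_ge0 ?invr_ge0.
  - by lra.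
  rewrite /s !natrM le_eqVlt; apply/orP; left; apply/eqP.
  by field; rewrite !lt0r_neq0 // ltr0n.
rewrite sumr_const -[leLHS]mulr_natl card_draws card_ord exprM.
have le_bin := bin_le_expr R n x0.
apply: le_trans (ler_wpM2r _ le_bin) _; first by rewrite !exprn_ge0 //; lra.
rewrite -exprMn.
have le_base : 4 * n%:R / x%:R * (1 / 16) ^+ s <= (1 / 2 : R).
  have : n%:R / x%:R <= 2 * 2 ^+ s :> R.
    by rewrite ler_pdivrMr // -exprS -natrX -natrM ler_nat [leqRHS]mulnC.
  have -> : (1 / 16) ^+ s = (1 / 2) ^+ s * (1 / 8) ^+ s :> R.
    by rewrite -exprMn; congr (_ ^+ _); field.
  have : 2 ^+ s * (1 / 2) ^+ s = 1 :> R by rewrite -exprMn mul1r divff ?expr1n // pnatr_eq0.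
  have : (1 / 8) ^+ s <= (1 / 8) ^+ 2 :> R.
    by apply: ler_wiXn2l; rewrite ?leq_pmulr //; lra || (rewrite /s; lia).
  have : 0 <= (1 / 8) ^+ s :> R by apply: exprn_ge0; lra.
  have : 0 <= (1 / 2) ^+ s :> R by apply: exprn_ge0; lra.
  have -> : 4 * n%:R / x%:R = 4 * (n%:R / x%:R) :> R by ring.
  move: (n%:R / x%:R) ((1 / 2) ^+ s) ((1 / 8) ^+ s) (2 ^+ s) => q a b c.
  move=> a0 b0 le_b ca le_q.
  have le1 : q * a <= 2 by nra.
  have : q * a * b <= 2 * b by apply: ler_wpM2r.
  rewrite expr2 in le_b; lra.
apply: (@le_trans _ _ ((1 / 2) ^+ x)).
  apply: lerXn2r; rewrite ?nnegrE //; last lra.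
  by rewrite !mulr_ge0 ?invr_ge0 // exprn_ge0 // divr_ge0.
rewrite expr_div_n expr1n -natrX ler_pdivlMr // mulrAC ler_pdivrMr ?ltr0n ?expn_gt0 //.
rewrite mul1r -natrM ler_nat; apply: (leq_trans le_n); rewrite mulnC leq_mul2l.
by rewrite ltnW ?orbT // ltn_expl.
Qed.

Let A : R := 8192 * D%:R ^+ 3.

(** Choosing the [y] vertices costs about [n ^ y], which [y] of the edges pay for; the
    [h = uphalf y] excess edges leave at most [(A * h / n) ^ h]. One of these factors supplies
    [1 / n]; the others, at most [1 / 16] each, give geometric decay in [y]. *)
Lemma dense_term y z : (0 < y <= z)%N -> (z * 2 ^ s <= 8 * n)%N ->
  'C(n + n, y)%:R * ('C(y * y, y + uphalf y)%:R * (D%:R / n%:R) ^+ (y + uphalf y))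
    <= 16 * A / n%:R * (1 / 2) ^+ y :> R.
Proof.
case/andP=> y0 le_yz le_z; set h := uphalf y.
have h0 : (0 < h)%N by rewrite /h; case: (y) y0.
have y2h : (y <= 2 * h)%N by rewrite /h; lia.
have le_hy : (h <= y)%N by rewrite /h; lia.
have D1 : 1 <= D%:R :> R by rewrite ler1n.
have y0R : 0 < y%:R :> R by rewrite ltr0n.
have q0 : 0 <= D%:R / n%:R :> R by rewrite divr_ge0.
have yh0 : (0 < y + h)%N by rewrite addn_gt0 y0.
have le1 := bin_le_expr R (n + n) y0.
have le2 := bin_le_expr R (y * y) yh0.
have {}le1 : 'C(n + n, y)%:R <= (8 * n%:R / y%:R) ^+ y :> R.
  by apply: le_trans le1 _; rewrite natrD le_eqVlt; apply/orP; left; apply/eqP;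
     congr (_ ^+ _); field; rewrite lt0r_neq0.
have {}le2 : 'C(y * y, y + h)%:R <= (4 * y%:R) ^+ (y + h) :> R.
  apply: le_trans le2 _; apply: lerXn2r; rewrite ?nnegrE ?mulr_ge0 ?invr_ge0 //.
  rewrite ler_pdivrMr ?ltr0n // natrM -mulrA ler_pM2l // ler_pM2l // ler_nat.
  exact: leq_addr.
apply: (@le_trans _ _ ((8 * n%:R / y%:R) ^+ y *
  ((4 * y%:R) ^+ (y + h) * (D%:R / n%:R) ^+ (y + h)))).
  apply: ler_pM => //; first by rewrite mulr_ge0 // exprn_ge0.
  by apply: ler_wpM2r => //; rewrite exprn_ge0.
rewrite -exprMn exprD mulrA -exprMn.
have -> : 8 * n%:R / y%:R * (4 * y%:R * (D%:R / n%:R)) = 32 * D%:R :> R.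
  by field; rewrite !lt0r_neq0.
apply: (@le_trans _ _ ((32 * D%:R) ^+ (2 * h) * (8 * h%:R * (D%:R / n%:R)) ^+ h)).
  apply: ler_pM; rewrite ?exprn_ge0 ?mulr_ge0 ?invr_ge0 //.
    by apply: ler_weXn2l => //; lra.
  apply: lerXn2r; rewrite ?nnegrE ?mulr_ge0 ?invr_ge0 //.
  apply: ler_wpM2r => //; rewrite -!natrM ler_nat -[8%N]/(4 * 2)%N -mulnA.
  by rewrite leq_mul2l.
rewrite exprM -exprMn.
have -> : (32 * D%:R) ^+ 2 * (8 * h%:R * (D%:R / n%:R)) = A * h%:R / n%:R.
  by rewrite /A; field; rewrite lt0r_neq0.
set B := A * h%:R / n%:R.
have B0 : 0 <= B by rewrite /B /A !mulr_ge0 ?invr_ge0 // exprn_ge0.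
(* Here [s] is large enough for [2 ^ 20 * D ^ 3 <= 2 ^ s], and [2 ^ 20] is 128 times the constant
   8192 of [A]. *)
have B16 : B <= 1 / 16.
  rewrite /B ler_pdivrMr //.
  have D_exp : (2 ^ 20 * D ^ 3 <= 2 ^ s)%N.
    apply: (@leq_trans (2 ^ (20 * D) * 2 ^ (D * 3)))%N.
      rewrite [(2 ^ (D * 3))%N]expnM; apply: leq_mul; first by rewrite leq_exp2l // leq_pmulr.
      by apply: leq_expl; apply: ltnW; apply: ltn_expl.
    by rewrite -expnD leq_exp2l // [(D * 3)%N]mulnC -mulnDl leq_mul2r orbT.
  have le_n : (2 ^ 20 * D ^ 3 * h <= 8 * n)%N.
    apply: leq_trans le_z; apply: (leq_trans (leq_mul D_exp (leqnn h))).
    by rewrite mulnC leq_mul2r (leq_trans le_hy) ?orbT.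
  have : 2 ^+ 20 * D%:R ^+ 3 * h%:R <= 8 * n%:R :> R.
    by rewrite -!natrX -!natrM ler_nat.
  have -> : 2 ^+ 20 * D%:R ^+ 3 * h%:R = 128 * (A * h%:R) :> R by rewrite /A; ring.
  by lra.
have -> : 16 * A / n%:R = 16 * (A / n%:R) by ring.
apply: (@le_trans _ _ (B * (1 / 16) ^+ h.-1)).
  have -> : B ^+ h = B * B ^+ h.-1 by rewrite -exprS prednK.
  by apply: ler_wpM2l => //; apply: lerXn2r; rewrite ?nnegrE //; lra.
have h4 : (h <= 4 ^ h)%N by apply/ltnW/ltn_expl.
have -> : B = A / n%:R * h%:R by rewrite /B mulrAC.
have AN0 : 0 <= A / n%:R by rewrite /A !mulr_ge0 ?invr_ge0 // exprn_ge0.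
suff : h%:R * (1 / 16) ^+ h.-1 <= 16 * (1 / 2) ^+ y :> R.
  by move/(ler_wpM2l AN0); rewrite !mulrA [_ * 16]mulrC !mulrA.
have -> : (1 / 16) ^+ h.-1 = 16 * (1 / 16) ^+ h :> R.
  by rewrite -[in RHS](prednK h0) exprS; field.
rewrite mulrCA ler_pM2l //; apply: (@le_trans _ _ ((1 / 4) ^+ h)).
  have -> : (1 / 16) ^+ h = (1 / 4) ^+ h * (1 / 4) ^+ h :> R.
    by rewrite -exprMn; congr (_ ^+ _); field.
  rewrite mulrA ler_piMl ?exprn_ge0 ?divr_ge0 //.
  rewrite mul1r exprVn ler_pdivrMr ?exprn_gt0 // mul1r -natrX ler_nat.
  exact: h4.
have -> : 1 / 4 = (1 / 2) ^+ 2 :> R by rewrite expr2; field.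
rewrite -exprM; apply: ler_wiXn2l => //; lra.
Qed.

Lemma sum_half_le z : \sum_(y < z) (1 / 2) ^+ y.+1 <= 1 :> R.
Proof.
have -> : \sum_(y < z) (1 / 2) ^+ y.+1 = 1 - (1 / 2) ^+ z :> R.
  elim: z => [|z IHz]; first by rewrite big_ord0 expr0 subrr.
  by rewrite big_ord_recr /= IHz exprS; field.
by rewrite lerBlDr lerDl exprn_ge0 // divr_ge0.
Qed.

Lemma Pr_dense_small z : (z * 2 ^ s <= 8 * n)%N ->
  Pr (fun E => [exists Z : {set 'I_n + 'I_n},
     [&& 0 < #|Z|, #|Z| <= z & 3 * #|Z| <= 2 * #|E :&: inner_pairs Z|]%N])
  <= 16 * A / n%:R.
Proof.
move=> le_z.
pose k y := (y + uphalf y)%N.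
pose DZ := [set Z : {set 'I_n + 'I_n} | 0 < #|Z| <= z]%N.
apply: (@le_trans _ _ (Pr (fun E => [exists Z in DZ, k #|Z| <= #|E :&: inner_pairs Z|]%N))).
  apply: Pr_le => E /existsP[Z /and3P[Z0 Zz dense]]; apply/exists_inP; exists Z.
    by rewrite inE Z0.
  by rewrite /k; lia.
apply: (le_trans (Pr_exists _ _)).
pose b y : R := 'C(y * y, k y)%:R * (D%:R / n%:R) ^+ k y.
apply: (@le_trans _ _ (\sum_(Z in DZ) b #|Z|)).
  apply: ler_sum => Z _; apply: le_trans (Pr_many_le _ _) _.
  rewrite ler_wpM2r ?exprn_ge0 ?divr_ge0 // ler_nat.
  exact/leq_bin2l/card_inner_pairs.
rewrite (partition_big (fun Z : {set _} => inord #|Z| : 'I_z.+1) predT) //=.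
have card_size (y : nat) : #|[set Z : {set 'I_n + 'I_n} | #|Z| == y]| = 'C(n + n, y).
  by rewrite card_draws card_sum card_ord.
(* No set of [DZ] is empty, so size 0 contributes nothing, although [b 0 = 1]. *)
apply: (@le_trans _ _ (\sum_(y < z.+1) (if y == 0 :> nat then 0 else 'C(n + n, y)%:R * b y))).
  apply: ler_sum => y _.
  have sel (Z : {set 'I_n + 'I_n}) : (Z \in DZ) && (inord #|Z| == y) -> (0 < #|Z|)%N && (#|Z| == y).
    rewrite inE => /andP[/andP[Z0 Zz] /eqP<-]; rewrite Z0 inordK //=.
  case: ifP => [y0|y0].
    rewrite big_pred0 // => Z; apply/negP => /sel /andP[Z0 /eqP Zy].
    by rewrite Zy (eqP y0) in Z0.
  rewrite (eq_bigr (fun=> b y)) => [|Z /sel/andP[_ /eqP->] //].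
  rewrite sumr_const -[leLHS]mulr_natl ler_wpM2r //.
    by rewrite mulr_ge0 // exprn_ge0 // divr_ge0.
  rewrite -card_size ler_nat; apply/subset_leq_card/subsetP => Z.
  by rewrite unfold_in => /sel/andP[_]; rewrite inE.
rewrite big_ord_recl eqxx add0r.
apply: (@le_trans _ _ (\sum_(y < z) 16 * A / n%:R * (1 / 2) ^+ y.+1)).
  by apply: ler_sum => y _; apply: (dense_term _ le_z); rewrite /=.
rewrite -mulr_sumr ler_piMr ?sum_half_le //.
by rewrite /A !mulr_ge0 ?invr_ge0 // exprn_ge0.
Qed.

End RandomEdges.

Lemma Pr_irregular (R : realType) (D : nat) : (0 < D)%N ->
  exists C : R, forall (n : nat) (p : R),
    0 <= p <= 1 -> (0 < n)%N -> p <= D%:R / n%:R -> (2 ^ (64 * D) <= n)%N ->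
    Pr p (fun E : {set 'I_n * 'I_n} => irregular E (64 * D)%N (n %/ 2 ^ (64 * D))%N)
      <= C / n%:R.
Proof.
move=> D0; have [s s_def] : exists s, s = (64 * D)%N by exists (64 * D)%N.
exists ((2 ^ s.+1)%:R + ((2 ^ s.+1)%:R + 16 * (8192 * D%:R ^+ 3))) => n p p01 n0 pD.
have high := Pr_many_high p01 n0 D0 pD; have dense := Pr_dense_small p01 n0 D0 pD.
rewrite -s_def in high dense *; move=> le_n; set x := (n %/ _)%N.
have x0 : (0 < x)%N by rewrite divn_gt0 // expn_gt0.
(* Rounding down loses at most a factor 2, because [x] is positive. *)
have xn : (n <= x * 2 ^ s.+1)%N.
  have lt_n : (n < x.+1 * 2 ^ s)%N by apply: ltn_ceil; rewrite expn_gt0.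
  apply: leq_trans (ltnW lt_n) _; rewrite (expnS 2 s) mulnA leq_mul2r.
  by rewrite muln2 -addnn -[x.+1]addn1 leq_add2l x0 orbT.
have left := high (fun L => setX L setT) x _ x0 xn.
have right := high (fun L => setX setT L) x _ x0 xn.
rewrite mulrDl; apply: le_trans (Pr_setU p01 _ _) _; apply: lerD.
  by apply: left => L; rewrite cardsX cardsT card_ord.
rewrite mulrDl; apply: le_trans (Pr_setU p01 _ _) _; apply: lerD.
  by apply: right => L; rewrite cardsX cardsT card_ord mulnC.
by apply: dense; rewrite -mulnA leq_mul2l leq_trunc_div.
Qed.

(* Exponents and the limit *)
From mathcomp Require Import all_classical all_reals all_analysis.
Import numFieldNormedType.Exports.

(** For a fixed labelling the [n ^ 2 / 4] pairs of the wrong colour are all non-edges with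
    probability at most [expR (- (d * n / 4))]. There are at most [2 * 2 ^ (4 * r * n)] labellings
    with a colour, and [32 * r <= d] bounds this by [2 * expR (d * n / 8)]. *)
Lemma Pr_has_block_map (R : realType) (n r K : nat) (d : R) :
  (0 < n)%N -> 1 <= d -> d <= n%:R -> 32 * r%:R <= d -> (K * 2 ^ r.+1 <= n)%N ->
  Pr (d / n%:R) (@has_block_map (2 * r)%N n K) <= 16 / n%:R.
Proof.
move=> n0 d1 dn rd leK; have n0R : 0 < n%:R :> R by rewrite ltr0n.
have p01 : 0 <= d / n%:R <= 1.
  by rewrite divr_ge0 ?ler_pdivrMr ?mul1r //; lra.
pose T : finType := (bool * {ffun 'I_n + 'I_n -> {set 'I_(2 * r)}})%type.
pose A (x : T) (E : {set 'I_n * 'I_n}) := E \subset monochromatic_map x.1 x.2.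
pose I : pred T := fun x => low_fibres K x.2.
apply: (@le_trans _ _ (\sum_(x in I) Pr (d / n%:R) (A x))).
  exact: (@Pr_exists R n (d / n%:R) p01 T I A).
pose B : R := expR (- (d * n%:R / 4)).
have le_B x : x \in I -> Pr (d / n%:R) (A x) <= B.
  case: x => b f; rewrite unfold_in /I /= => low_f.
  rewrite /A Pr_sub /=; set k := #|_|.
  have le_k : (n ^ 2 <= 4 * k)%N.
    have fib v : (#|[set i | f (inl i) == v]| <= K)%N /\ (#|[set i | f (inr i) == v]| <= K)%N.
      by have /forallP/(_ v)/andP := low_f.
    have := @inner_product_balanced (2 * r) n K (f \o inl) (f \o inr)
              (fun v => proj1 (fib v)) (fun v => proj2 (fib v)) _ (~~ b).
    have -> : k = #|[set p | odd #|(f \o inl) p.1 :&: (f \o inr) p.2| == ~~ b]|.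
      by apply: eq_card => p; rewrite !inE /=; case: (odd _); case: (b).
    apply; have -> : (4 * K ^ 2 * 2 ^ (2 * r) = (K * 2 ^ r.+1) ^ 2)%N.
      by rewrite [(2 * r)%N]mulnC expnM (expnS 2 r) -!mulnn; move: (2 ^ r)%N => q; nia.
    by rewrite leq_exp2r.
  have le1 : 1 - d / n%:R <= expR (- (d / n%:R)).
    by have := expR_ge1Dx (- (d / n%:R)).
  apply: (@le_trans _ _ (expR (- (d / n%:R)) ^+ k)).
    by apply: lerXn2r; rewrite ?nnegrE ?expR_ge0 //; lra.
  rewrite -expRM_natl ler_expR mulrN lerN2.
  have le_kR : n%:R ^+ 2 <= 4 * k%:R :> R by rewrite -natrX -natrM ler_nat.
  rewrite mulrA ler_pdivlMr //.
  rewrite expr2 in le_kR.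
  have : d * (n%:R * n%:R) <= d * (4 * k%:R) by apply: ler_wpM2l => //; lra.
  by lra.
apply: (le_trans (ler_sum _ le_B)).
rewrite sumr_const -[leLHS]mulr_natl.
have le_I : (#|I| <= 2 * (2 ^ (4 * r * n)))%N.
  apply: leq_trans (max_card _) _; rewrite card_prod card_bool leq_mul2l /=.
  rewrite card_ffun card_sum card_ord -cardsT -powersetT card_powerset cardsT card_ord.
  by rewrite -expnM leq_exp2l //; lia.
have B0 : 0 <= B by apply: expR_ge0.
apply: (@le_trans _ _ ((2 * (2 ^ (4 * r * n)))%N%:R * B)).
  by apply: ler_wpM2r => //; rewrite ler_nat.
rewrite natrM natrX.
have le2 : 2 ^+ (4 * r * n) <= expR (d * n%:R / 8) :> R.
  have two_e : 2 <= expR 1 :> R by apply: le_trans (expR_ge1Dx 1); lra.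
  apply: (@le_trans _ _ (expR 1 ^+ (4 * r * n))).
    by apply: lerXn2r; rewrite ?nnegrE ?expR_ge0.
  rewrite -expRM_natl mulr1 ler_expR !natrM.
  have : 32 * r%:R * n%:R <= d * n%:R by apply: ler_wpM2r => //; rewrite ltW.
  by lra.
have E0 := expR_gt0 (d * n%:R / 8).
have EB : expR (d * n%:R / 8) * B = (expR (d * n%:R / 8))^-1.
  by rewrite -expRN /B -expRD; congr expR; field.
rewrite -mulrA; apply: (@le_trans _ _ (2 * (expR (d * n%:R / 8))^-1)).
  by rewrite -EB; apply: ler_wpM2l => //; apply: ler_wpM2r.
have le_e : n%:R / 8 <= expR (d * n%:R / 8).
  apply: le_trans (expR_ge1Dx _).
  have : 1 * n%:R <= d * n%:R by apply: ler_wpM2r => //; rewrite ltW.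
  by lra.
rewrite ler_pdivrMr // mulrAC ler_pdivlMr //; lra.
Qed.

Lemma ramsey_lower_exponent (R : realType) (n r : nat) (d : R) (E : {set 'I_n * 'I_n}) :
  32 * r%:R <= d -> d < 32 * r.+1%:R -> (2 ^ r.+1 <= n)%N ->
  ~~ has_block_map (2 * r)%N (n %/ 2 ^ r.+1)%N E ->
  2 `^ (1 / 128 * d) * n%:R <= (ramsey (bip_graph E))%:R.
Proof.
move=> rd dr le_n no_map; set K := (n %/ 2 ^ r.+1)%N in no_map.
(* For small [d] the [2 * n] vertices of the graph suffice. Otherwise [r >= 4], and the block
   colouring gives [2 ^ (r - 2) * n], where [d / 128 < (r + 1) / 4 <= r - 2]. *)
have [d_small|d_large] := lerP d 128.
  apply: (@le_trans _ _ (2 * n%:R)).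
    apply: ler_wpM2r => //; rewrite -[leRHS](@powRr1 R 2) //.
    by apply: ler_powR; lra.
  rewrite -natrM ler_nat; apply: leq_trans (ramsey_geq_card _).
  by rewrite card_sum card_ord mul2n addnn.
have lt_ramsey : (K * 2 ^ (2 * r) < ramsey (bip_graph E))%N.
  rewrite ltnNge; apply: contra no_map => le_N.
  exact: block_colouring le_N (ramsey_arrowP _).
have [q def_r] : exists q, r = q.+3.
  exists (r - 3)%N; have : (4 < r.+1)%N by rewrite -(ltr_nat R); lra.
  by lia.
have le_K : (2 ^ q.+1 * n <= K * 2 ^ (2 * r))%N.
  have K0 : (0 < K)%N by rewrite /K divn_gt0 // expn_gt0.
  have : (n < K.+1 * 2 ^ r.+1)%N by apply: ltn_ceil; rewrite expn_gt0.
  move=> lt_n; have {lt_n} : (n <= K * 2 ^ r.+2)%N.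
    apply: leq_trans (ltnW lt_n) _; rewrite (expnS 2 r.+1) mulnA leq_mul2r.
    by rewrite muln2 -addnn -[K.+1]addn1 leq_add2l K0 orbT.
  have -> : (2 * r = q.+1 + r.+2)%N by lia.
  by rewrite expnD mulnCA leq_mul2l => ->; rewrite orbT.
apply: (@le_trans _ _ ((2 ^ q.+1 * n)%N%:R)); last first.
  by rewrite ler_nat; apply: leq_trans le_K (ltnW lt_ramsey).
rewrite natrM ler_wpM2r // natrX -powR_mulrn //; apply: ler_powR; first by lra.
by move: dr; rewrite def_r -(addn4 q) -(addn1 q) !natrD; have := ler0n R q; lra.
Qed.

Lemma ramsey_upper_exponent (R : realType) (n D x : nat) (d : R) (E : {set 'I_n * 'I_n}) :
  (0 < n)%N -> (0 < D)%N -> 1 <= d -> D%:R <= d + 1 -> ~~ irregular E (64 * D)%N x ->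
  (ramsey (bip_graph E))%:R <= 2 `^ (2400 * d) * n%:R.
Proof.
move=> n0 D0 d1 dD reg; have [s s_def] : exists s, s = (64 * D)%N by exists (64 * D)%N.
have s0 : (12 <= s)%N by lia.
have peel : peelable (bip_edge E) s by rewrite s_def in s0 *; apply: regular_peelable reg.
have := ramsey_upper n0 (ltnW (leq_trans (isT : (1 < 12)%N) s0)) peel.
rewrite -(ler_nat R) => /le_trans; apply.
rewrite natrM ler_wpM2r // natrX -powR_mulrn //; apply: ler_powR; first by lra.
(* The exponent is [1152 * D + 10], at most [1152 * (d + 1) + 10], and [1 <= d]. *)
rewrite natrD natrM s_def natrM; lra.
Qed.

Local Open Scope classical_set_scope.

Theorem theorem1p5 (R : realType) :
  exists c1 c2 : R, [/\ 0 < c1, 0 < c2 &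
    forall d : R, 1 <= d ->
      (fun n : nat => Gnnp_prob n (d / n%:R) (fun H : sgraph =>
         2 `^ (c1 * d) * n%:R <= (ramsey H)%:R <= 2 `^ (c2 * d) * n%:R))
      @ \oo --> (1 : R)].
Proof.
exists (1 / 128), 2400; split=> [||d d1]; [lra | lra |].
have d0 : 0 <= d by lra.
have [D [D0 dD Dd]] : exists D : nat, [/\ (0 < D)%N, d <= D%:R & D%:R <= d + 1].
  exists (Num.truncn d).+1; have /andP[le_d lt_d] := truncn_itv d0.
  by rewrite (ltW lt_d) -natr1 lerD2r le_d.
have [r [rd dr]] : exists r : nat, 32 * r%:R <= d /\ d < 32 * r.+1%:R.
  have d32 : 0 <= d / 32 by rewrite divr_ge0.
  exists (Num.truncn (d / 32)); have /andP[le_d lt_d] := truncn_itv d32.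
  by rewrite mulrC -ler_pdivlMr // le_d [32 * _]mulrC -ltr_pdivrMr.
have [C0 PrC0] := Pr_irregular R D0.
apply/cvgrPdist_le => e e0.
have [m lt_m] : exists m : nat, (16 + C0) / e <= m%:R.
  by exists (Num.truncn ((16 + C0) / e)).+1; rewrite ltW // truncnS_gt.
(* The summands ensure in turn that [d / n] is a probability, that [n %/ 2 ^ (64 * D)] and the block
   size are positive, and that the failure probability [(16 + C0) / n] is at most [e]. *)
exists (D + 2 ^ (64 * D) + 2 ^ r.+1 + m)%N => // n /= le_n.
have [Dn sn rn mn] : [/\ D <= n, 2 ^ (64 * D) <= n, 2 ^ r.+1 <= n & m <= n]%N.
  by move: (2 ^ (64 * D))%N (2 ^ r.+1)%N le_n => a b le_n; split; lia.
have n0 : (0 < n)%N := leq_trans D0 Dn.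
have n0R : 0 < n%:R :> R by rewrite ltr0n.
have dn : d <= n%:R by rewrite (le_trans dD) // ler_nat.
have p01 : 0 <= d / n%:R <= 1 by rewrite divr_ge0 // ler_pdivrMr // mul1r.
have pD : d / n%:R <= D%:R / n%:R by rewrite ler_wpM2r // invr_ge0 ltW.
pose good (E : {set 'I_n * 'I_n}) : bool :=
  2 `^ (1 / 128 * d) * n%:R <= (ramsey (bip_graph E))%:R <= 2 `^ (2400 * d) * n%:R.
rewrite -[Gnnp_prob _ _ _]/(Pr (d / n%:R) good).
move: PrC0 => /(_ n _ p01 n0 pD sn) P2.
have P1 := Pr_has_block_map n0 d1 dn rd (leq_trunc_div n (2 ^ r.+1)).
set b1 := has_block_map _ _ in P1; set b2 := (fun E => irregular _ _ _) in P2.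
have goodP E : ~~ good E -> b1 E || b2 E.
  apply: contraR; rewrite negb_or => /andP[n1 n2]; apply/andP; split.
    exact: ramsey_lower_exponent n1.
  exact: ramsey_upper_exponent n2.
have bad0 := Pr_ge0 p01 (fun E => ~~ good E).
have -> : 1 - Pr (d / n%:R) good = Pr (d / n%:R) (fun E => ~~ good E).
  have tot : 1 = Pr (d / n%:R) good + Pr (d / n%:R) (fun E => ~~ good E).
    by rewrite -[LHS](Pr_total n (d / n%:R)) /Pr [LHS](bigID good).
  by rewrite [X in X - _]tot addrAC subrr add0r.
rewrite ger0_norm //; apply: le_trans (Pr_le p01 goodP) _.
apply: le_trans (Pr_setU p01 b1 b2) _; apply: le_trans (lerD P1 P2) _.
rewrite -mulrDl ler_pdivrMr // mulrC -ler_pdivrMr //.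
by apply: le_trans lt_m _; rewrite ler_nat.
Qed.
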